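(* Let $\mu$ be a finite signature and let $\mathfrak C$ be a hereditary class of finite relational structures of signature $\mu$. Then: (1) either $\mathfrak C$ is a finite union of ages of relational structures, each admitting a finite monomorphic decomposition; (2) or $\mathfrak C$ contains the age $\mathfrak D$ of a relational structure $\mathcal R$ that does not have a finite monomorphic decomposition, this age being minimal (with respect to inclusion) with this property, i.e. minimal among the ages of relational structures that do not have a finite monomorphic decomposition.
   Context: A relational structure of signature $\mu=(n_i)_{i\in I}$ is a pair $\mathcal R=(V,(\rho_i)_{i\in I})$ where $V$ is a set (the domain) and each $\rho_i\subseteq V^{n_i}$ is an $n_i$-ary relation on $V$; the signature is finite if $I$ is finite. $\mathcal R_{\restriction A}$ denotes the substructure induced on $A\subseteq V$. $\mathcal R$ embeds into $\mathcal R'$ if $\mathcal R$ is isomorphic to an induced substructure of $\mathcal R'$. Finite structures are considered up to isomorphism. A class $\mathfrak C$ of structures of signature $\mu$ is hereditary if every structure embeddable into a member of $\mathfrak C$ belongs to $\mathfrak C$. The age of $\mathcal R$ is the set $\mathrm{Age}(\mathcal R)$ of the induced substructures of $\mathcal R$ on finite subsets of its domain, considered up to isomorphism. A monomorphic decomposition of $\mathcal R$ is a partition $(V_j)_{j\in J}$ of its domain $V$ such that for all finite subsets $A,A'$ of $V$, the induced structures $\mathcal R_{\restriction A}$ and $\mathcal R_{\restriction A'}$ are isomorphic whenever $|A\cap V_j|=|A'\cap V_j|$ for every $j\in J$. It is finite if it has finitely many blocks. *)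

(* Defs.v *)
From mathcomp Require Import all_boot.
From mathcomp Require Import boolp classical_sets cardinality.

Set Implicit Arguments.
Unset Strict Implicit.
Unset Printing Implicit Defensive.

Local Open Scope classical_set_scope.
Local Open Scope card_scope.

Record structure (I : Type) (mu : I -> nat) := Structure {
  dom : Type;
  rel_of : forall i : I, set ((mu i).-tuple dom)
}.

Arguments Structure {I mu} dom rel_of.
Arguments dom {I mu} s.
Arguments rel_of {I mu} s i _.

Section RelationalStructures.
Variables (I : Type) (mu : I -> nat).

Local Notation structure := (structure mu).
Implicit Types R S : structure.

Definition finite_structure R : Prop := finite_set [set: dom R].

(* The domain is [sig A] and not [set_type A]: the latter lives in a fixed
   universe of the library, which must stay unrelated to that of [dom]. *)
Definition restrict R (A : set (dom R)) : structure :=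
  Structure {x : dom R | A x}
    (fun i => [set t | rel_of R i (map_tuple (@sval _ _) t)]).

Definition isomorphic R S : Prop :=
  exists f : dom R -> dom S, bijective f /\
    forall (i : I) (t : (mu i).-tuple (dom R)),
      rel_of R i t <-> rel_of S i (map_tuple f t).

Definition embeds R S : Prop :=
  exists A : set (dom S), isomorphic R (restrict A).

(* "Up to isomorphism": classes, and in particular ages, are isomorphism-closed
   classes of structures rather than sets of isomorphism types. *)
Definition hereditary (C : set structure) : Prop :=
  forall R S, C S -> embeds R S -> C R.

Definition age R : set structure :=
  [set S | exists A : set (dom R), finite_set A /\ isomorphic S (restrict A)].

Definition monomorphic_decomposition R (J : Type) (B : J -> set (dom R)) : Prop :=
  partition [set: J] B [set: dom R] /\
  forall A A' : set (dom R), finite_set A -> finite_set A' ->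
    (forall j : J, A `&` B j #= A' `&` B j) ->
    isomorphic (restrict A) (restrict A').

Definition has_finite_monomorphic_decomposition R : Prop :=
  exists (J : finType) (B : J -> set (dom R)), monomorphic_decomposition B.

Definition age_without_fmd (D : set structure) : Prop :=
  exists R, ~ has_finite_monomorphic_decomposition R /\ D = age R.

Definition minimal_age_without_fmd (D : set structure) : Prop :=
  age_without_fmd D /\
  forall D' : set structure, age_without_fmd D' -> D' `<=` D -> D' = D.

End RelationalStructures.

(* Main.v *)
(* Say that a finite structure has complexity at most N when its points can be
   coloured with N colours and ranked in such a way that its relations are preserved
   by the maps that preserve the colours and, within each colour, the order of the
   ranks. By Dickson's lemma, structures of complexity at most N are well
   quasi-ordered by embeddability. A structure R has a finite monomorphic
   decomposition iff the complexity is bounded on its age: for "only if", Ramsey's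
   theorem turns infinite blocks into indiscernible sequences; for "if", the relation
   "x and y are exchangeable in every finite set" has finitely many classes.

   The key finiteness statement is that if every one-point deletion of R has
   complexity at most N, then R has complexity bounded in terms of N and of the
   arities. Compare the colourings and orders of the deletions R - a_0, ..., R - a_m:
   on each colour class either the order is irrelevant, or it is definable from the
   first and last few points of the classes, so that any two of the orders agree or
   are opposite on boundedly many pieces.

   If the complexity is bounded on C, then C is well quasi-ordered, hence a finite
   union of ages, and these are ages of structures with finite monomorphic
   decompositions. Otherwise Zorn's lemma gives a minimal hereditary subclass D of C
   of unbounded complexity: were the intersection of a chain of unbounded classes
   bounded, the minimal structures outside it would have bounded complexity by the
   key statement, and a descent along the chain would contradict well
   quasi-ordering. By minimality D is directed, so it is an age. *)
Require Import Defs.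
From mathcomp Require Import all_boot.
From mathcomp Require Import boolp classical_sets cardinality.
From mathcomp Require Import perm zify.

Set Implicit Arguments.
Unset Strict Implicit.
Unset Printing Implicit Defensive.

(** * Tuples, updated families and enumerations *)

Lemma map_tupleK (n : nat) (T U W : Type) (f : T -> U) (g : U -> W)
    (t : n.-tuple T) :
  map_tuple g (map_tuple f t) = map_tuple (g \o f) t.
Proof. by apply: val_inj; rewrite /= map_comp. Qed.

Lemma eq_map_tuple (n : nat) (T U : Type) (f g : T -> U) (t : n.-tuple T) :
  (forall a, f (tnth t a) = g (tnth t a)) -> map_tuple f t = map_tuple g t.
Proof. by move=> fg; apply: eq_from_tnth => a; rewrite !tnth_map. Qed.

Lemma map_tuple_id (n : nat) (T : Type) (t : n.-tuple T) : map_tuple id t = t.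
Proof. by apply: val_inj; rewrite /= map_id. Qed.

Lemma map_tuple_cancel (n : nat) (T U : Type) (f : T -> U) (g : U -> T)
    (t : n.-tuple T) : cancel f g -> map_tuple g (map_tuple f t) = t.
Proof.
by move=> fK; rewrite map_tupleK -[RHS]map_tuple_id; apply: eq_map_tuple => a /=.
Qed.

Definition upd (V : eqType) (T : Type) (e : V -> T) (v : V) (x : T) : V -> T :=
  fun w => if w == v then x else e w.

Lemma upd_same (V : eqType) (T : Type) (e : V -> T) v x : upd e v x v = x.
Proof. by rewrite /upd eqxx. Qed.

Lemma upd_other (V : eqType) (T : Type) (e : V -> T) v x w :
  w != v -> upd e v x w = e w.
Proof. by rewrite /upd => /negbTE ->. Qed.

Lemma upd_inj (V : eqType) (T : Type) (e : V -> T) v x :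
  injective e -> (forall w, w != v -> e w <> x) -> injective (upd e v x).
Proof.
move=> einj ex w w'; rewrite /upd.
case: (eqVneq w v) => [->|wv]; case: (eqVneq w' v) => [->|w'v] //.
- by move=> xe; case: (ex w' w'v).
- by move=> xe; case: (ex w wv).
- exact: einj.
Qed.

Lemma upd_upd (V : eqType) (T : Type) (e : V -> T) v x y :
  upd (upd e v x) v y = upd e v y.
Proof. by apply: funext => w; rewrite /upd; case: (w == v). Qed.

Lemma upd_id (V : eqType) (T : Type) (e : V -> T) v : upd e v (e v) = e.
Proof. by apply: funext => w; rewrite /upd; case: eqP => [->|]. Qed.

Definition ord_of (n : nat) (k : {k : nat | k < n}) : 'I_n :=
  Ordinal (svalP k).

Definition of_ord (n : nat) (k : 'I_n) : {k : nat | k < n} :=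
  exist _ (val k) (ltn_ord k).

Arguments ord_of {n}.
Arguments of_ord {n}.

Lemma ord_ofK (n : nat) : cancel (@ord_of n) (@of_ord n).
Proof. by case=> k kn; congr exist; apply: bool_irrelevance. Qed.

Lemma of_ordK (n : nat) : cancel (@of_ord n) (@ord_of n).
Proof. by move=> k; apply: val_inj. Qed.

Lemma finite_set_enum (T : Type) (A : set T) : finite_set A ->
  exists (n : nat) (e : 'I_n -> T), injective e /\ A = range e.
Proof.
move=> /finite_setP[n /card_set_bijP[f [fto finj fsurj]]].
have pre (k : 'I_n) : exists x, A x /\ f x = k.
  by have [x Ax fx] := fsurj k (ltn_ord k); exists x.
have [e eP] := choice pre; exists n, e; split.
  by move=> k l ekl; apply: val_inj; rewrite /= -(eP k).2 -(eP l).2 ekl.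
apply/seteqP; split=> [x Ax|_ [k _ <-]]; last by case: (eP k).
exists (Ordinal (fto x Ax)) => //; apply: finj; rewrite ?inE //.
  by case: (eP (Ordinal (fto x Ax))).
by rewrite (eP _).2.
Qed.

(** * Embeddings, isomorphisms and ages *)

Section Structures.
Local Open Scope classical_set_scope.
Variables (I : Type) (mu : I -> nat).
Local Notation structure := (structure mu).
Implicit Types R S : structure.

(* ['I_n] lives in a universe of the library that is too large for [dom], hence
   the domain [{k | k < n}] in [Set]. *)
Definition pull R (n : nat) (e : 'I_n -> dom R) : structure :=
  Structure {k : nat | k < n}
    (fun i => [set t | rel_of R i (map_tuple (e \o ord_of) t)]).

Definition embedding R S (f : dom R -> dom S) : Prop :=
  injective f /\ forall i t, rel_of R i t <-> rel_of S i (map_tuple f t).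

Lemma embedding_comp R S T (f : dom R -> dom S) (g : dom S -> dom T) :
  embedding f -> embedding g -> embedding (g \o f).
Proof.
move=> [finj fR] [ginj gR]; split; first exact: inj_comp.
by move=> i t; rewrite fR gR map_tupleK.
Qed.

Lemma embedding_val R (A : set (dom R)) :
  embedding (R := restrict A) (S := R) (@sval _ _).
Proof.
split=> [[x xA] [y yA] /= xy|//].
by case: _ / xy yA => yA; congr exist; apply: Prop_irrelevance.
Qed.

Lemma iso_embedding R S : isomorphic R S ->
  exists f : dom R -> dom S, bijective f /\ embedding f.
Proof.
move=> [f [fbij fR]]; exists f; split=> //; split=> //; exact: bij_inj.
Qed.

Lemma iso_refl R : isomorphic R R.
Proof.
exists id; split; first by exists id.
by move=> i t; rewrite map_tuple_id.
Qed.

Lemma iso_sym R S : isomorphic R S -> isomorphic S R.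
Proof.
move=> [f [[g fK gK] fR]]; exists g; split; first by exists f.
by move=> i t; rewrite fR map_tuple_cancel.
Qed.

Lemma iso_trans R S T : isomorphic R S -> isomorphic S T -> isomorphic R T.
Proof.
move=> [f [fbij fR]] [g [gbij gR]]; exists (g \o f); split.
  exact: bij_comp.
by move=> i t; rewrite fR gR map_tupleK.
Qed.

Lemma restrict_range_iso R S (f : dom S -> dom R) (A : set (dom R)) :
  embedding f -> A = range f -> isomorphic S (restrict A).
Proof.
move=> [finj fR] ->.
have mem x : range f (f x) by exists x.
exists (fun x => exist _ (f x) (mem x)); split.
  have pre (y : {y | range f y}) : exists x, f x = sval y.
    by case: y => /= y [x _ <-]; exists x.
  have [g gP] := choice pre; exists g => [x|y].
    by apply: finj; rewrite gP.
  by apply: (@embedding_val R (range f)).1; rewrite /= gP.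
move=> i t; rewrite fR /= map_tupleK; by [].
Qed.

Lemma embedsP R S : embeds R S <-> exists f : dom R -> dom S, embedding f.
Proof.
split; [case=> A /iso_embedding[f [_ fE]]|case=> f fE].
  by exists ((@sval _ _) \o f); apply: embedding_comp fE _; apply: embedding_val.
by exists (range f); apply: (restrict_range_iso fE).
Qed.

Lemma embeds_refl R : embeds R R.
Proof. by apply/embedsP; exists id; split=> // i t; rewrite map_tuple_id. Qed.

Lemma embeds_trans R S T : embeds R S -> embeds S T -> embeds R T.
Proof.
move=> /embedsP[f fE] /embedsP[g gE]; apply/embedsP.
by exists (g \o f); apply: embedding_comp.
Qed.

Lemma iso_embeds R S : isomorphic R S -> embeds R S.
Proof. by move=> /iso_embedding[f [_ fE]]; apply/embedsP; exists f. Qed.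

Lemma pull_iso R S n (e : 'I_n -> dom R) (f : 'I_n -> dom S) :
  bijective f ->
  (forall i (t : (mu i).-tuple 'I_n),
     rel_of R i (map_tuple e t) <-> rel_of S i (map_tuple f t)) ->
  isomorphic (pull e) S.
Proof.
move=> fbij fR; exists (f \o ord_of); split.
  by apply: bij_comp fbij _; exists (of_ord); [apply: ord_ofK|apply: of_ordK].
by move=> i t; rewrite /= -(map_tupleK ord_of e) -(map_tupleK ord_of f); apply: fR.
Qed.

Lemma pull_iso_pull R S n (e : 'I_n -> dom R) (f : 'I_n -> dom S)
    (g : 'I_n -> 'I_n) :
  injective g ->
  (forall i (t : (mu i).-tuple 'I_n),
     rel_of R i (map_tuple e t) <-> rel_of S i (map_tuple (f \o g) t)) ->
  isomorphic (pull e) (pull f).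
Proof.
move=> ginj gR; apply: (@pull_iso R (pull f) n e (of_ord \o g)).
  apply: bij_comp; first by exists (ord_of); [apply: of_ordK|apply: ord_ofK].
  exact: injF_bij.
move=> i t; rewrite gR /= map_tupleK.
have -> : map_tuple (f \o g) t
        = map_tuple ((f \o ord_of) \o (of_ord \o g)) t => [|//].
by apply: eq_map_tuple => a; rewrite /= of_ordK.
Qed.

Lemma pull_restrict_iso R n (e : 'I_n -> dom R) (A : set (dom R)) :
  injective e -> A = range e -> isomorphic (pull e) (restrict A).
Proof.
move=> einj ->; apply: (@restrict_range_iso R (pull e) (e \o ord_of)).
  split; first exact: inj_comp einj (can_inj (@ord_ofK n)).
  by move=> i t.
apply/seteqP; split=> x [k _ <-].
  by exists (of_ord k); rewrite //= of_ordK.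
by exists (ord_of k).
Qed.

Lemma finite_enumP R : finite_structure R <->
  exists (n : nat) (e : 'I_n -> dom R), bijective e.
Proof.
rewrite /finite_structure; split=> [/finite_set_enum[n [e [einj eE]]]|[n [e [g eK gK]]]].
  exists n, e; have pre x : exists k, e k = x.
    by have : [set: dom R] x by []; rewrite eE => -[k _ <-]; exists k.
  have [g gP] := choice pre; exists g => [k|x //]; exact: einj.
have -> : [set: dom R] = range e.
  by apply/seteqP; split=> // x _; exists (g x).
by apply: finite_image; apply: finite_finset.
Qed.

Lemma finite_embeds R S : embeds R S -> finite_structure S -> finite_structure R.
Proof.
move=> /embedsP[f [finj _]] /(@finite_preimage _ _ _ f); apply.
by move=> x y _ _; apply: finj.
Qed.

Lemma ageP R S : age R S <-> finite_structure S /\ embeds S R.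
Proof.
split=> [[A [Afin /iso_embedding[f [_ fE]]]]|[Sfin /embedsP[f fE]]].
  have gE := embedding_comp fE (@embedding_val R A).
  split; last by apply/embedsP; exists ((@sval _ _) \o f).
  have := @finite_preimage _ _ A ((@sval _ _) \o f).
  have -> : ((@sval _ _) \o f) @^-1` A = [set: dom S].
    by apply/seteqP; split=> // x _; rewrite /preimage /=; apply: svalP.
  by apply=> // x y _ _; apply: gE.1.
exists (range f); split; last exact: restrict_range_iso fE _.
by apply: finite_image.
Qed.

Lemma age_hereditary R : hereditary (age R).
Proof.
move=> S T /ageP[Tfin TR] ST; apply/ageP; split; last exact: embeds_trans TR.
exact: finite_embeds Tfin.
Qed.

End Structures.

(** * Colourings and ranks *)

Section Below.
Variables (V : finType) (D : {set V}) (r : V -> nat).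

(** When [r] is injective on [D], ranks become positions 0, 1, ... within [D], so that coloured sets
    can be matched position by position. *)
Definition below (x : V) : nat := #|[set y in D | r y < r x]|.

Lemma below_lt x y : x \in D -> r x < r y -> below x < below y.
Proof.
move=> xD xy; apply: proper_card; apply/properP; split.
  by apply/fintype.subsetP => z; rewrite !inE => /andP[-> /= /ltn_trans]; apply.
by exists x; rewrite !inE ?xD ?ltnn.
Qed.

Lemma below_leE x y : x \in D -> y \in D -> (below x <= below y) = (r x <= r y).
Proof.
move=> xD yD; case: (leqP (r x) (r y)) => xy.
  apply: subset_leq_card; apply/fintype.subsetP => z; rewrite !inE => /andP[-> /= zx].
  exact: leq_trans xy.
by apply/negbTE; rewrite -ltnNge; apply: below_lt.
Qed.

Lemma below_bound x : x \in D -> below x < #|D|.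
Proof.
move=> xD; apply: proper_card; apply/properP; split.
  by apply/fintype.subsetP => z; rewrite !inE => /andP[].
by exists x; rewrite // !inE ltnn andbF.
Qed.

(** Positions are distinct and smaller than [#|D|], so by counting each of them is taken. *)
Lemma below_surj (i : nat) :
  {in D &, injective r} -> i < #|D| -> exists2 x, x \in D & below x = i.
Proof.
move=> rinj iD; case cD: #|D| iD => [//|n] iD.
pose f (x : V) : 'I_n.+1 := inord (below x).
have fE x : x \in D -> f x = below x :> nat.
  by move=> xD; rewrite inordK // -cD below_bound.
have finj : {in D &, injective f}.
  move=> x y xD yD fxy; apply: rinj => //; apply/eqP; rewrite eqn_leq.
  by rewrite -!below_leE // -!fE // fxy leqnn.
have /finset.setP/(_ (Ordinal iD)) : f @: D = [set: 'I_n.+1].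
  by apply/eqP; rewrite eqEcard finset.subsetT cardsT card_ord card_in_imset // cD leqnn.
by rewrite inE => /imsetP[x xD fx]; exists x; rewrite // -fE // -fx.
Qed.

End Below.

(** A point goes to the point of the same colour that has the same position in its class; the class
    in [W] is large enough to have one. *)
Lemma colour_embedding (V W K : finType) (c : V -> K) (r : V -> nat)
    (c' : W -> K) (r' : W -> nat) :
  (forall x y, c x = c y -> r x = r y -> x = y) ->
  (forall x y, c' x = c' y -> r' x = r' y -> x = y) ->
  (forall k, #|[set v | c v == k]| <= #|[set w | c' w == k]|) ->
  exists f : V -> W, [/\ injective f, forall v, c' (f v) = c v &
    forall u v, c u = c v -> (r u <= r v) = (r' (f u) <= r' (f v))].
Proof.
move=> inj inj' cnt.
pose D k := [set v | c v == k]; pose D' k := [set w | c' w == k].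
have inD v : v \in D (c v) by rewrite inE.
have pre v : exists w, c' w = c v /\
    below (D' (c v)) r' w = below (D (c v)) r v.
  have [|| w] := @below_surj _ (D' (c v)) r' (below (D (c v)) r v).
  - by move=> x y; rewrite !inE => /eqP cx /eqP cy; apply: inj'; rewrite cx.
  - exact: leq_trans (below_bound _ _) (cnt _).
  by rewrite inE => /eqP cw bw; exists w.
have [f fP] := choice pre.
have fc v : c' (f v) = c v by case: (fP v).
have fr u v : c u = c v -> (r u <= r v) = (r' (f u) <= r' (f v)).
  move=> cuv; have [_ bu] := fP u; have [_ bv] := fP v.
  rewrite -(@below_leE _ (D (c v))) ?inE ?cuv // -bv -cuv -bu cuv.
  by rewrite below_leE // inE fc ?cuv.
exists f; split=> // u v fuv.
have cuv : c u = c v by rewrite -!fc fuv.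
by apply: inj => //; apply/eqP; rewrite eqn_leq !fr // fuv leqnn.
Qed.

Section Pattern.
Variables (I : Type) (mu : I -> nat).
Local Notation structure := (structure mu).
Implicit Types R S : structure.

Definition compatible (K T U : Type)
    (rho : forall i, (mu i).-tuple T -> Prop) (c : T -> K) (r : T -> nat)
    (rho' : forall i, (mu i).-tuple U -> Prop) (c' : U -> K) (r' : U -> nat) :=
  forall i (t : (mu i).-tuple T) (t' : (mu i).-tuple U),
    (forall a, c (tnth t a) = c' (tnth t' a)) ->
    (forall a b, c (tnth t a) = c (tnth t b) ->
      (r (tnth t a) <= r (tnth t b)) = (r' (tnth t' a) <= r' (tnth t' b))) ->
    (rho i t <-> rho' i t').

Definition separating (K T : Type) (c : T -> K) (r : T -> nat) : Prop :=
  forall x y, c x = c y -> r x = r y -> x = y.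

(* Up to isomorphism, [good c r] says that [R] is an induced substructure of a
   structure on [K * nat] whose relations are invariant under the partial maps
   preserving the first coordinate and, within each fibre, the order. *)
Definition good (K : Type) R (c : dom R -> K) (r : dom R -> nat) : Prop :=
  separating c r /\ compatible (rel_of R) c r (rel_of R) c r.

Definition cx (N : nat) R : Prop :=
  exists (c : dom R -> 'I_N) (r : dom R -> nat), good c r.

Lemma good_embedding (K : Type) R S (f : dom R -> dom S) (c : dom S -> K) r :
  embedding f -> good c r -> good (c \o f) (r \o f).
Proof.
move=> [finj fR] [inj g]; split=> [x y cxy rxy|i t t' tc tr].
  by apply: finj; apply: inj.
rewrite !fR; apply: g => [a|a b]; first by rewrite !tnth_map; apply: tc.
by rewrite !tnth_map; apply: tr.
Qed.

Lemma good_cx (K : finType) R (c : dom R -> K) r N :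
  good c r -> #|K| <= N -> cx N R.
Proof.
move=> [inj g] KN; pose h k : 'I_N := widen_ord KN (enum_rank k).
have hinj : injective h.
  by move=> x y /(congr1 val) /= xy; apply: enum_rank_inj; apply: val_inj.
exists (h \o c), r; split=> [x y /= /hinj|i t t' tc tr]; first exact: inj.
apply: g => [a|a b cab]; first by apply: hinj; apply: tc.
by apply: tr; rewrite /= cab.
Qed.

Lemma cx_leq M N R : M <= N -> cx M R -> cx N R.
Proof. by move=> MN [c [r g]]; apply: (good_cx g); rewrite card_ord. Qed.

Lemma cx_embeds N R S : embeds R S -> cx N S -> cx N R.
Proof.
move=> /embedsP[f fE] [c [r g]].
by exists (c \o f), (r \o f); apply: good_embedding.
Qed.

Lemma compatible_map (K : finType) n p R S (e : 'I_n -> dom R)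
    (f : 'I_p -> dom S) (c : dom R -> K) r (c' : dom S -> K) r' :
  injective e -> injective f -> separating c r -> separating c' r' ->
  compatible (rel_of R) c r (rel_of S) c' r' ->
  (forall k, #|[set v | c (e v) == k]| <= #|[set w | c' (f w) == k]|) ->
  exists2 g : 'I_n -> 'I_p, injective g &
    forall i (t : (mu i).-tuple 'I_n),
      rel_of R i (map_tuple e t) <-> rel_of S i (map_tuple (f \o g) t).
Proof.
move=> einj finj inj inj' comp cnt.
have [||g [ginj gc gr]] :=
    @colour_embedding 'I_n 'I_p K (c \o e) (r \o e) (c' \o f) (r' \o f) _ _ cnt.
- by move=> x y /= cxy rxy; apply: einj; apply: inj.
- by move=> x y /= cxy rxy; apply: finj; apply: inj'.
exists g => // i t.
apply: comp => [a|a b]; first by rewrite !tnth_map; apply: esym; apply: gc.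
by rewrite !tnth_map => cab; apply: gr.
Qed.

End Pattern.

(** * Well quasi-ordering of structures of bounded complexity *)

Section WellQuasiOrder.
Variables (I : finType) (mu : I -> nat).
Local Notation structure := (structure mu).
Implicit Types R S : structure.

(** On each tail of [f] some index attains the minimum; iterating this choice gives nondecreasing
    values. *)
Lemma monotone_subsequence (f : nat -> nat) :
  exists2 phi : nat -> nat, {homo phi : a b / a < b} &
    {homo (f \o phi) : a b / a <= b}.
Proof.
have pre n : exists k, n <= k /\ forall l, n <= l -> f k <= f l.
  have ex : exists y, `[< exists2 k, n <= k & f k = y >].
    by exists (f n); apply/asboolP; exists n.
  case: (ex_minnP ex) => y /asboolP[k nk fk] ymin; exists k; split=> // l nl.
  by rewrite fk; apply: ymin; apply/asboolP; exists l.
have [g gP] := choice pre.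
pose fix phi n := if n is n'.+1 then g (phi n').+1 else g 0.
have phiS n : phi n < phi n.+1 by have [] := gP (phi n).+1.
have phimono : {homo phi : a b / a < b}.
  exact: (homo_ltn ltn_trans).
exists phi => //; apply: (homo_leq leqnn leq_trans) => n /=.
case: n => [|n]; first by have [_] := gP 0; apply.
by have [_] := gP (phi n).+1; apply; apply: leq_trans (phiS _) (ltnW (phiS _)).
Qed.

Lemma monotone_subsequences (p : nat) (f : nat -> 'I_p -> nat) :
  exists2 phi : nat -> nat, {homo phi : a b / a < b} &
    forall k, {homo (fun n => f (phi n) k) : a b / a <= b}.
Proof.
elim: p f => [|p IHp] f; first by exists id => // -[].
have [phi phiS phif] := monotone_subsequence (fun n => f n ord_max).
have [psi psiS psif] := IHp (fun n k => f (phi n) (widen_ord (leqnSn p) k)).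
exists (phi \o psi) => [a b ab|k]; first by apply: phiS; apply: psiS.
case: (ltnP k p) => kp.
  have -> : k = widen_ord (leqnSn p) (Ordinal kp) by apply: val_inj.
  exact: psif.
have -> : k = ord_max.
  by apply: val_inj; apply/eqP; rewrite eqn_leq kp -ltnS ltn_ord.
move=> a b; rewrite leq_eqVlt => /predU1P[->|ab]; first exact: leqnn.
by apply: phif; apply: ltnW; apply: psiS.
Qed.

(* Dickson's lemma. A coordinate with values in [U] is made constant by requiring
   both its rank and its complementary rank to be nondecreasing. *)
Lemma increasing_pair (p : nat) (U : finType) (f : nat -> 'I_p -> nat)
    (u : nat -> U) :
  exists a b, [/\ a < b, u a = u b & forall k, f a k <= f b k].
Proof.
pose g n (k : 'I_p.+2) : nat :=
  if unlift ord0 k is Some k' then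
    if unlift ord0 k' is Some l then f n l else enum_rank (u n)
  else #|U| - enum_rank (u n).
have [phi phiS phig] := monotone_subsequences g.
exists (phi 0), (phi 1); split; first exact: phiS.
  apply: enum_rank_inj; apply: val_inj; apply/eqP; rewrite eqn_leq /=.
  have := phig (lift ord0 ord0) _ _ (leq0n 1).
  have := phig ord0 _ _ (leq0n 1).
  rewrite /g !liftK !unlift_none => le1 ->; move: le1 => /=.
  have lt1 := ltn_ord (enum_rank (u (phi 1))).
  have lt0 := ltn_ord (enum_rank (u (phi 0))).
  by rewrite leq_sub2lE // ltnW.
by move=> k; have := phig (lift ord0 (lift ord0 k)) _ _ (leq0n 1); rewrite /g !liftK.
Qed.

(** As [I] is finite there are finitely many patterns, hence finitely many templates; this allows
    Dickson's lemma to make two templates equal. *)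
Definition pattern (N : nat) (i : I) : finType :=
  ({ffun 'I_(mu i) -> 'I_N} * {set 'I_(mu i) * 'I_(mu i)})%type.

Definition pattern_of (N : nat) (T : Type) (c : T -> 'I_N) (r : T -> nat) i
    (t : (mu i).-tuple T) : pattern N i :=
  ([ffun a => c (tnth t a)],
   [set ab | (c (tnth t ab.1) == c (tnth t ab.2)) &&
             (r (tnth t ab.1) <= r (tnth t ab.2))]%SET).

(* A good pair [(c, r)] is coded by the finite set of patterns of related tuples. *)
Definition template (N : nat) R (c : dom R -> 'I_N) (r : dom R -> nat) :
    {set {i : I & pattern N i}} :=
  [set u | `[< exists2 t, rel_of R (tag u) t & pattern_of c r t = tagged u >]]%SET.

(** In a good structure the pattern of a tuple decides whether it is related, so a related tuple of
    one structure yields a related tuple with the same pattern in the other. *)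
Lemma template_compatible N R S (c : dom R -> 'I_N) r (c' : dom S -> 'I_N) r' :
  good c r -> good c' r' -> template c r = template c' r' ->
  compatible (rel_of R) c r (rel_of S) c' r'.
Proof.
move=> [_ gR] [_ gS] eqT i t t' tc tr.
have patE : pattern_of c r t = pattern_of c' r' t'.
  congr pair; first by apply/ffunP => a; rewrite !ffunE.
  apply/finset.setP => -[a b]; rewrite !inE /= -!tc.
  by case: eqP => //= /tr.
have same (T : structure) (d : dom T -> 'I_N) s (v v' : (mu i).-tuple (dom T)) :
    compatible (rel_of T) d s (rel_of T) d s ->
    pattern_of d s v = pattern_of d s v' -> rel_of T i v -> rel_of T i v'.
  move=> gT [/ffunP pc /finset.setP pr]; apply: (iffLR (gT _ _ _ _ _)).
    by move=> a; have := pc a; rewrite !ffunE.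
  move=> a b dab; have := pr (a, b); rewrite !inE /= dab eqxx /=.
  have := pc a; have := pc b; rewrite !ffunE => <- <-; rewrite dab eqxx; exact.
split=> rt.
  have : Tagged (pattern N) (pattern_of c' r' t') \in template c r.
    by rewrite inE; apply/asboolP; exists t.
  by rewrite eqT inE => /asboolP[/= v rv /(same _ _ _ _ _ gS)]; apply.
have : Tagged (pattern N) (pattern_of c r t) \in template c' r'.
  by rewrite inE; apply/asboolP; exists t'.
by rewrite -eqT inE => /asboolP[/= v rv /(same _ _ _ _ _ gR)]; apply.
Qed.

(** The template and the sizes of the colour classes determine the structure; for equal templates,
    smaller classes give an embedding. Dickson's lemma supplies such a pair. *)
Lemma cx_wqo (N : nat) (R : nat -> structure) :
  (forall n, finite_structure (R n)) -> (forall n, cx N (R n)) ->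
  exists a b, a < b /\ embeds (R a) (R b).
Proof.
move=> Rfin Rcx.
have pre n : exists u : {set {i : I & pattern N i}} * ('I_N -> nat),
    exists c r d (e : 'I_d -> dom (R n)), [/\ good c r, bijective e,
      template c r = u.1 & forall k, #|[set v | c (e v) == k]%SET| = u.2 k].
  have [c [r g]] := Rcx n; have /finite_enumP[d [e ebij]] := Rfin n.
  exists (template c r, fun k => #|[set v | c (e v) == k]%SET|).
  by exists c, r, d, e.
have [u uP] := choice pre.
have [a [b [ab uab cab]]] := increasing_pair (fun n => (u n).2) (fun n => (u n).1).
exists a, b; split=> //.
have [c [r [d [e [g ebij tc cn]]]]] := uP a.
have [c' [r' [d' [e' [g' e'bij tc' cn']]]]] := uP b.
rewrite -tc -tc' in uab.
have [|f finj fR] := compatible_map (bij_inj ebij) (bij_inj e'bij) g.1 g'.1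
  (template_compatible g g' uab); first by move=> k; rewrite cn cn'.
have [h eK hK] := ebij.
apply/embedsP; exists (e' \o f \o h); split.
  by apply: inj_comp (can_inj hK); apply: inj_comp finj; apply: bij_inj e'bij.
move=> i t; have := fR i (map_tuple h t).
by rewrite (map_tuple_cancel _ hK) map_tupleK.
Qed.

End WellQuasiOrder.

(** * Blocks of a good colouring *)

Section Sim.
Variables (I : Type) (mu : I -> nat) (T : Type).
Variable rho : forall i, (mu i).-tuple T -> Prop.

(** For injective families this says that sending [e v] to [f v] is an isomorphism between the
    induced structures. *)
Definition sim (V : Type) (e f : V -> T) : Prop :=
  forall i (s : (mu i).-tuple V), rho (map_tuple e s) <-> rho (map_tuple f s).

Lemma sim_refl (V : Type) (e : V -> T) : sim e e.
Proof. by []. Qed.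

Lemma sim_sym (V : Type) (e f : V -> T) : sim e f -> sim f e.
Proof. by move=> ef i s; split=> /ef. Qed.

Lemma sim_trans (V : Type) (e f g : V -> T) : sim e f -> sim f g -> sim e g.
Proof. by move=> ef fg i s; split=> [/ef /fg|/fg /ef]. Qed.

Lemma sim_comp (V W : Type) (g : W -> V) (e f : V -> T) :
  sim e f -> sim (e \o g) (f \o g).
Proof.
by move=> ef i s; rewrite -(map_tupleK g e) -(map_tupleK g f); apply: ef.
Qed.

End Sim.

Section Blocks.
Variables (I : Type) (mu : I -> nat) (T K : finType).
Variable rho : forall i, (mu i).-tuple T -> Prop.
Variables (m : nat) (A : {set T}) (c : T -> K) (r : T -> nat).
Hypothesis sepA : forall x y, x \in A -> y \in A -> c x = c y -> r x = r y -> x = y.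
Hypothesis goodA : forall i (t t' : (mu i).-tuple T),
  (forall a, tnth t a \in A) -> (forall a, tnth t' a \in A) ->
  (forall a, c (tnth t a) = c (tnth t' a)) ->
  (forall a b, c (tnth t a) = c (tnth t b) ->
     (r (tnth t a) <= r (tnth t b)) = (r (tnth t' a) <= r (tnth t' b))) ->
  (rho t <-> rho t').
Local Notation sim := (sim rho).
Implicit Types (V : finType) (x y z : T).

Lemma sim_order V (e f : V -> T) :
  (forall v, e v \in A) -> (forall v, f v \in A) ->
  (forall v, c (e v) = c (f v)) ->
  (forall u v, c (e u) = c (e v) ->
     (r (e u) <= r (e v)) = (r (f u) <= r (f v))) ->
  sim e f.
Proof.
move=> eA fA ef er i s; apply: goodA => [a|a|a|a b]; rewrite !tnth_map //.
exact: er.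
Qed.

Lemma ltA x y : x \in A -> y \in A -> c x = c y -> x != y ->
  (r x <= r y) = (r x < r y).
Proof.
move=> xA yA cxy xy; rewrite leq_eqVlt; case: eqP => // rxy.
by rewrite (sepA xA yA cxy rxy) eqxx in xy.
Qed.

Definition block (j : K) : {set T} := [set x in A | c x == j].
(** Reversing ranks makes positions from the top of a block an instance of [below]; the maximum over
    all of [T] keeps the subtraction from being truncated. *)
Let rev x := \max_y r y - r x.

Lemma rev_lt x y : (rev x < rev y) = (r y < r x).
Proof.
have := leq_bigmax (F := r) x; have := leq_bigmax (F := r) y; rewrite /rev; lia.
Qed.

Lemma rev_le x y : (rev x <= rev y) = (r y <= r x).
Proof. by rewrite leqNgt rev_lt -leqNgt. Qed.

(* In each block, [ends] consists of the [m] first and the [m] last elements. *)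
Definition lo x := below (block (c x)) r x.
Definition hi x := below (block (c x)) rev x.
Definition mid : {set T} := [set x in A | (m <= lo x) && (m <= hi x)].
Definition ends : {set T} := A :\: mid.

Lemma midA x : x \in mid -> x \in A.
Proof. by rewrite inE => /andP[]. Qed.

Lemma endsA x : x \in ends -> x \in A.
Proof. by rewrite inE => /andP[]. Qed.

Lemma ends_mid x y : x \in ends -> y \in mid -> x != y.
Proof. by move=> xE yM; apply: contraTneq xE => ->; rewrite inE yM. Qed.

Lemma in_ends x : x \in A -> (lo x < m) || (hi x < m) -> x \in ends.
Proof. by move=> xA; rewrite !inE xA !(leqNgt m) /= andbT -negb_or negbK. Qed.

Lemma blockA j x : x \in block j -> x \in A /\ c x = j.
Proof. by rewrite inE => /andP[-> /eqP]. Qed.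

Lemma in_block x : x \in A -> x \in block (c x).
Proof. by rewrite inE eqxx => ->. Qed.

(** A point of the block that is neither below [x] nor above [y] has the rank of [x], hence is
    [x]. *)
Lemma card_block x y : x \in A -> y \in A -> c x = c y -> r y <= r x ->
  #|block (c x)| <= lo x + hi y + 1.
Proof.
move=> xA yA cxy yx; rewrite /lo /hi /below -cxy.
apply: leq_trans (leq_add (leq_card_setU _ _) (leqnn 1)).
rewrite -(cards1 x); apply: leq_trans (leq_card_setU _ _).
apply: subset_leq_card; apply/fintype.subsetP => z zB.
rewrite !inE rev_lt; have := zB; rewrite inE => /andP[zA /eqP cz].
rewrite zA cz eqxx /=; case: ltnP => //= xz; case: ltnP => //= zy.
by apply/eqP; apply: sepA => //; lia.
Qed.

(** At least [m] points lie below [y] and [m] above it. This leaves room for a point outside two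
    families of [m] points. *)
Lemma mid_room y : y \in mid -> 2 * m < #|block (c y)|.
Proof.
rewrite inE => /and3P[yA ly hy].
have disj : [disjoint [set z in block (c y) | r z < r y]
                    & [set z in block (c y) | rev z < rev y]].
  apply/pred0P => z /=; rewrite !inE rev_lt; apply/negbTE; lia.
have sub : y |: ([set z in block (c y) | r z < r y]
             :|: [set z in block (c y) | rev z < rev y]) \subset block (c y).
  by apply/fintype.subsetP => z; rewrite !inE; case: eqP => [->|_]; rewrite ?yA ?eqxx //=; lia.
move/subset_leq_card: sub; rewrite cardsU1 !inE ltnn rev_lt ltnn !andbF /=.
move: disj; rewrite -leq_card_setU => /eqP ->.
move: ly hy; rewrite /lo /hi /below; lia.
Qed.

Lemma fresh j (F : {set T}) : #|F| < #|block j| -> exists2 x, x \in block j & x \notin F.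
Proof.
move=> lt; apply/exists_inP; rewrite -negb_forall_in; apply: contraL lt => /forall_inP sub.
by rewrite -leqNgt; apply: subset_leq_card; apply/fintype.subsetP.
Qed.

Lemma card_ends : #|ends| <= 2 * m * #|K|.
Proof.
(* A point of [ends] is coded by its colour and its position, below [m], from the bottom or from the
   top of its block; [inr tt] is a default never taken on [ends]. *)
pose h x : (K * ('I_m + 'I_m)) + unit :=
  if insub (lo x) is Some k then inl (c x, inl k) else
  if insub (hi x) is Some k then inl (c x, inr k) else inr tt.
have hP x : x \in ends -> exists k : 'I_m,
    (h x = inl (c x, inl k) /\ lo x = k) \/ (h x = inl (c x, inr k) /\ hi x = k).
  move=> xE; rewrite /h; case: insubP => [k _ <-|lx]; first by exists k; left.
  case: insubP => [k _ <-|hx]; first by exists k; right.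
  move: (xE); rewrite !inE (endsA xE) /=.
  by rewrite -!leqNgt in lx hx; rewrite lx hx.
have lohi x y : x \in ends -> y \in ends -> c x = c y ->
    lo x = lo y \/ hi x = hi y -> x = y.
  move=> /endsA xA /endsA yA cxy; have bx := in_block xA; have by_ := in_block yA.
  rewrite -cxy in by_; rewrite /lo /hi -cxy => -[] e; apply: sepA => //; apply/eqP;
    rewrite eqn_leq.
    by rewrite -!(below_leE r bx by_) -(below_leE r by_ bx) e leqnn.
  by rewrite -!rev_le -(below_leE rev bx by_) -(below_leE rev by_ bx) e leqnn.
have hinj : {in ends &, injective h}.
  move=> x y xE yE; have [k] := hP x xE; have [l] := hP y yE.
  case=> [] [-> ly] [] [-> lx] // [cxy kl]; apply: lohi => //.
    by left; rewrite lx ly kl.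
  by right; rewrite lx ly kl.
rewrite -(card_in_imset hinj).
have sub : h @: ends \subset [set inl u | u in [set: K * ('I_m + 'I_m)]].
  apply/fintype.subsetP => _ /imsetP[x /hP[k [] [-> _]] ->];
  by apply: imset_f; rewrite inE.
apply: leq_trans (subset_leq_card sub) _.
apply: leq_trans (leq_imset_card _ _) _.
by rewrite cardsT card_prod card_sum card_ord; lia.
Qed.

(* A configuration of at most [m] points can be pushed into [ends] without changing
   its order pattern; [side] prescribes which points go below the middle of their
   block. *)
Lemma shift V (S : {set V}) (e : V -> T) (side : pred V) :
  {in S &, injective e} -> {in S, forall w, e w \in A} -> #|S| <= m ->
  (forall u w, u \in S -> w \in S -> c (e u) = c (e w) -> r (e u) <= r (e w) ->
     side w -> side u) ->
  exists f : V -> T,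
    [/\ {in S, forall w, f w \in ends /\ c (f w) = c (e w)},
        {in S &, forall u w, c (e u) = c (e w) ->
           (r (e u) <= r (e w)) = (r (f u) <= r (f w))} &
        {in S, forall w y, y \in mid -> c y = c (e w) ->
           (r (f w) < r y) = side w}].
Proof.
move=> einj eA Sm mono.
pose D w := [set u in S | c (e u) == c (e w)].
have DE u w : c (e u) = c (e w) -> D u = D w by rewrite /D => ->.
have inD w : w \in S -> w \in D w by rewrite inE eqxx => ->.
have DB w : #|D w| <= #|block (c (e w))|.
  have einjD : {in D w &, injective e}.
    by move=> u v; rewrite !inE => /andP[uS _] /andP[vS _]; apply: einj.
  rewrite -(card_in_imset einjD); apply: subset_leq_card.
  apply/fintype.subsetP => z /imsetP[u]; rewrite inE => /andP[uS cu] ->.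
  by rewrite inE eA.
have DS w : #|D w| <= m.
  apply: leq_trans Sm; apply: subset_leq_card.
  by apply/fintype.subsetP => u; rewrite inE => /andP[].
(* The position of [w] in its class [D w] is reproduced from the bottom of the block on the low
   side, from the top otherwise; it is below [m], so the point found is in [ends]. *)
have pre w : exists x, w \in S ->
    [/\ x \in ends, c x = c (e w) &
        if side w then lo x = below (D w) (r \o e) w
        else hi x = below (D w) (rev \o e) w].
  case: (boolP (w \in S)) => wS; last by exists (e w).
  have rinj : {in block (c (e w)) &, injective r}.
    by move=> x y /blockA[xA cx] /blockA[yA cy]; apply: sepA; rewrite ?cx.
  have revinj : {in block (c (e w)) &, injective rev}.
    move=> x y xB yB xy; apply: rinj => //; apply/eqP.
    by rewrite eqn_leq -!rev_le xy leqnn.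
  case: (boolP (side w)) => _.
    have lt := below_bound (r \o e) (inD _ wS).
    have [x xB xE] := below_surj rinj (leq_trans lt (DB w)).
    have [xA cx] := blockA xB; exists x; rewrite -cx in xE; split=> //.
    by apply: in_ends; rewrite // /lo xE (leq_trans lt (DS w)).
  have lt := below_bound (rev \o e) (inD _ wS).
  have [x xB xE] := below_surj revinj (leq_trans lt (DB w)).
  have [xA cx] := blockA xB; exists x; rewrite -cx in xE; split=> //.
  by apply: in_ends; rewrite // /hi xE (leq_trans lt (DS w)) orbT.
have [f fP] := choice pre.
have fE w : w \in S -> f w \in ends by case/fP.
have fA w : w \in S -> f w \in A by move/fE/endsA.
have fc w : w \in S -> c (f w) = c (e w) by case/fP.
have fb w : w \in S -> f w \in block (c (e w)).
  by move=> wS; rewrite -fc // in_block // fA.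
(* If the images were in the wrong order, [card_block] would make the block smaller than [D u],
   whose low and high points are counted by [lt1] and [lt2]. *)
have LR u w : u \in S -> w \in S -> c (e u) = c (e w) -> side u -> ~~ side w ->
    r (f u) < r (f w).
  move=> uS wS cuw su sw; rewrite ltnNge; apply/negP => wu.
  have cf : c (f u) = c (f w) by rewrite !fc.
  have := card_block (fA _ uS) (fA _ wS) cf wu; rewrite fc //.
  have [_ _] := fP u uS; rewrite su => ->; have [_ _] := fP w wS; rewrite (negbTE sw) => ->.
  rewrite -(DE _ _ cuw); have := DB u.
  have lt1 : below (D u) (r \o e) u < #|[set v in D u | side v]|.
    apply: proper_card; apply/properP; split; last first.
      by exists u; rewrite !inE ?uS ?eqxx ?su //= ltnn.
    apply/fintype.subsetP => v; rewrite !inE => /andP[/andP[vS cv] /= /ltnW vu].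
    by rewrite vS cv (mono v u) //; apply/eqP.
  have lt2 : below (D u) (rev \o e) w < #|[set v in D u | ~~ side v]|.
    apply: proper_card; apply/properP; split; last first.
      by exists w; rewrite !inE ?wS ?cuw ?eqxx ?sw //= ltnn.
    apply/fintype.subsetP => v; rewrite !inE /= rev_lt => /andP[/andP[vS cv] /ltnW wv].
    rewrite vS cv; apply: contra sw => sv; apply: mono wS vS _ wv sv.
    by rewrite -cuw; apply/esym/eqP.
  have dU : [set v in D u | side v] :|: [set v in D u | ~~ side v] = D u.
    by apply/finset.setP => v; rewrite !inE -andb_orr orbN andbT.
  have dI : [set v in D u | side v] :&: [set v in D u | ~~ side v] = finset.set0.
    by apply/finset.setP => v; rewrite !inE; case: (side v); rewrite !andbF.
  have := cardsUI [set v in D u | side v] [set v in D u | ~~ side v].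
  rewrite dU dI cards0; lia.
exists f; split=> [w wS|u w uS wS cuw|w wS y yM cy].
- by split; [apply: fE|apply: fc].
- have bu : f u \in block (c (e w)) by rewrite -cuw fb.
  have [_ _] := fP u uS; have [_ _] := fP w wS.
  rewrite /lo /hi !fc // cuw (DE _ _ cuw).
  case: (boolP (side u)) => su; case: (boolP (side w)) => sw => Ew Eu.
  + rewrite -(below_leE r bu (fb _ wS)) Ew Eu (below_leE (r \o e)) ?inD //.
    by rewrite -(DE _ _ cuw) inD.
  + rewrite (ltnW (LR u w _ _ _ _ _)) // leqNgt; apply/negP => /ltnW wu.
    by rewrite (mono w u wS uS (esym cuw) wu su) in sw.
  + rewrite [RHS]leqNgt (LR w u) //; apply/negbTE/negP => uw.
    by rewrite (mono u w uS wS cuw uw sw) in su.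
  + rewrite -2!rev_le -(below_leE rev (fb _ wS) bu) Ew Eu (below_leE (rev \o e)) ?inD //.
    by rewrite -(DE _ _ cuw) inD.
- have yB : y \in block (c (e w)) by rewrite -cy in_block // midA.
  have [_ _] := fP w wS; move: yM; rewrite inE => /and3P[yA].
  rewrite /lo /hi cy fc // => ly hy.
  case: (boolP (side w)) => sw E.
    rewrite ltnNge -(below_leE r yB (fb _ wS)) E -ltnNge; apply: leq_trans ly.
    by apply: leq_trans (below_bound _ (inD _ wS)) (DS w).
  apply/negbTE; rewrite -leqNgt -rev_le -(below_leE rev (fb _ wS) yB) E.
  apply: leq_trans hy; apply: ltnW.
  by apply: leq_trans (below_bound _ (inD _ wS)) (DS w).
Qed.

(* [tp1] and [tp2] are equality of the types over [ends] of points and of pairs. *)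
Definition tp1 x y : Prop := forall V (e : V -> T) v,
  #|V| <= m -> (forall w, w != v -> e w \in ends) -> sim (upd e v x) (upd e v y).

Definition tp2 x y x' y' : Prop := forall V (e : V -> T) u v,
  #|V| <= m -> u != v -> (forall w, w != u -> w != v -> e w \in ends) ->
  sim (upd (upd e u x) v y) (upd (upd e u x') v y').

(* A point of a symmetric block may be moved anywhere inside this block, so the
   order on such a block is irrelevant. *)
Definition symmetric_block (j : K) : Prop := forall V (e : V -> T) v x,
  #|V| <= m -> injective e -> (forall w, e w \in A) -> c (e v) = j ->
  x \in block j -> (forall w, e w != x) -> sim e (upd e v x).

Lemma tp1_sym x y : tp1 x y -> tp1 y x.
Proof. by move=> xy V e v Vm eE; apply: sim_sym; apply: xy. Qed.

Lemma updA V (e : V -> T) v x :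
  (forall w, e w \in A) -> x \in A -> forall w, upd e v x w \in A.
Proof. by move=> eA xA w; rewrite /upd; case: (w == v). Qed.

Lemma card_but1 V (v : V) : #|V| <= m -> #|[set w | w != v]| <= m.
Proof. by apply: leq_trans; apply: max_card. Qed.

(** Both families have the same colours and the same order in each colour: [y] stands among the
    shifted points as [x] does among the original ones. *)
Lemma anchor V (e f : V -> T) v x y :
  (forall w, w != v -> e w \in A) -> (forall w, w != v -> e w != x) ->
  x \in A -> y \in mid -> c y = c x ->
  (forall w, w != v -> f w \in ends /\ c (f w) = c (e w)) ->
  (forall u w, u != v -> w != v -> c (e u) = c (e w) ->
     (r (e u) <= r (e w)) = (r (f u) <= r (f w))) ->
  (forall w, w != v -> c (e w) = c x -> (r (f w) < r y) = (r (e w) < r x)) ->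
  sim (upd e v x) (upd f v y).
Proof.
move=> eA ex xA yM cyx fE fe fs.
have yA := midA yM.
have fA w : w != v -> f w \in A by move/fE => [/endsA].
have fc w : w != v -> c (f w) = c (e w) by move/fE => [].
have fy w : w != v -> f w != y by move/fE => [fwE _]; apply: ends_mid fwE yM.
apply: sim_order => [w|w|w|u w]; rewrite /upd.
- by case: (eqVneq w v) => // /eA.
- by case: (eqVneq w v) => // /fA.
- by case: (eqVneq w v) => // /fc.
case: (eqVneq u v) => [_|uv]; case: (eqVneq w v) => [_|wv] cuw; rewrite ?leqnn //.
- by rewrite leqNgt [RHS]leqNgt fs.
- rewrite (ltA (eA u uv) xA cuw (ex u uv)) (ltA (fA u uv) yA _ (fy u uv)) ?fs //.
  by rewrite fc // cuw.
- exact: fe.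
Qed.

(** With the other points shifted into [ends], the middle point [y] can stand for [e v] and [y'] for
    [x]; then [tp1] exchanges [y] and [y']. *)
Lemma cross V (e : V -> T) v x y y' :
  y \in mid -> y' \in mid -> c y != c y' -> tp1 y y' ->
  #|V| <= m -> injective e -> (forall w, e w \in A) -> c (e v) = c y ->
  x \in block (c y') -> (forall w, e w != x) -> sim e (upd e v x).
Proof.
move=> yM y'M yy' tpy Vm einj eA cv /blockA[xA cx] ex.
(* As the blocks of [y] and [y'] differ, one prescription serves both: position relative to [e v] in
   the first block, to [x] elsewhere. *)
pose side w := if c (e w) == c y then r (e w) < r (e v) else r (e w) < r x.
have [||||f] := @shift V [set w | w != v] e side.
- by move=> u w _ _; apply: einj.
- by move=> w _; apply: eA.
- exact: card_but1.
- move=> u w _ _ cuw uw; rewrite /side cuw.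
  by case: eqP => _; apply: leq_ltn_trans.
move=> [fE fe fs].
have {}fE w : w != v -> f w \in ends /\ c (f w) = c (e w).
  by move=> wv; apply: fE; rewrite inE.
have {}fe u w : u != v -> w != v -> c (e u) = c (e w) ->
    (r (e u) <= r (e w)) = (r (f u) <= r (f w)).
  by move=> uv wv; apply: fe; rewrite inE.
have {}fs w z : w != v -> z \in mid -> c z = c (e w) -> (r (f w) < r z) = side w.
  by move=> wv; apply: fs; rewrite inE.
apply: (@sim_trans _ _ _ _ _ _ (upd f v y)).
  rewrite -{1}(upd_id e v); apply: anchor => //.
  - by move=> w wv; apply: contra_neq wv; apply: einj.
  - by move=> w wv cw; rewrite fs // /side cw ?cv ?eqxx.
apply: (@sim_trans _ _ _ _ _ _ (upd f v y')).
  by apply: tpy => // w /fE[].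
apply: sim_sym; apply: anchor => //.
by move=> w wv cw; rewrite fs ?cw // /side cw cx eq_sym (negbTE yy').
Qed.

(* A point can be moved inside the first block by a detour through the second. *)
Lemma cross_symmetric y y' :
  y \in mid -> y' \in mid -> c y != c y' -> tp1 y y' -> symmetric_block (c y).
Proof.
move=> yM y'M yy' tpy V e v x Vm einj eA cv xB ex.
have [xA cx] := blockA xB.
have [|x' x'B x'e] := @fresh (c y') [set e w | w in V].
  apply: leq_ltn_trans (leq_imset_card _ _) _.
  by apply: leq_ltn_trans Vm _; have := mid_room y'M; lia.
have ex' w : e w != x' by apply: contraNneq x'e => <-; apply: imset_f.
have [_ cx'] := blockA x'B.
have S1 := cross yM y'M yy' tpy Vm einj eA cv x'B ex'.
apply: sim_trans S1 _; rewrite -(upd_upd e v x x'); apply: sim_sym.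
apply: (cross yM y'M) => //.
- by apply: upd_inj => // w _; apply/eqP.
- exact: updA.
- by rewrite upd_same.
move=> w; rewrite /upd; case: (w == v) => //.
by apply: contra_neq yy' => xx'; rewrite -cx -cx' xx'.
Qed.

(** No other point of the family separates [e u] from [e v] in their block, so [y] and [z] can stand
    for them once the other points are shifted into [ends]; [tp2] then exchanges the two. *)
Lemma transpose V (e : V -> T) u v y z :
  y \in mid -> z \in mid -> c y = c z -> r y < r z -> tp2 y z z y ->
  #|V| <= m -> injective e -> (forall w, e w \in A) ->
  c (e u) = c y -> c (e v) = c y -> r (e u) < r (e v) ->
  (forall w, w != u -> w != v -> c (e w) = c y ->
     (r (e w) < r (e u)) = (r (e w) < r (e v))) ->
  sim e (upd (upd e u (e v)) v (e u)).
Proof.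
move=> yM zM cyz yz tpyz Vm einj eA cu cv uv adj.
have yA := midA yM; have zA := midA zM.
have uNv : u != v by apply: contraTneq uv => ->; rewrite ltnn.
pose out w := (w != u) && (w != v).
have [||||f] := @shift V [set w | out w] e (fun w => r (e w) < r (e u)).
- by move=> w w' _ _; apply: einj.
- by move=> w _; apply: eA.
- by apply: leq_trans Vm; apply: max_card.
- by move=> w w' _ _ _; apply: leq_ltn_trans.
move=> [fE fe fs].
have fA w : out w -> f w \in A by move=> wo; have [|/endsA] := fE w; rewrite ?inE.
have fc w : out w -> c (f w) = c (e w) by move=> wo; have [|] := fE w; rewrite ?inE.
have fM w x : out w -> x \in mid -> f w != x.
  by move=> wo xM; have [|fwE _] := fE w; rewrite ?inE //; apply: ends_mid fwE xM.
have {}fe w w' : out w -> out w' -> c (e w) = c (e w') ->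
    (r (e w) <= r (e w')) = (r (f w) <= r (f w')).
  by move=> wo wo'; apply: fe; rewrite inE.
have {}fs w x : out w -> x \in mid -> c x = c (e w) ->
    (r (f w) < r x) = (r (e w) < r (e u)).
  by move=> wo; apply: fs; rewrite inE.
(* Two middle points put at [u] and [v] in the order of the original values reproduce the order
   pattern of [e]. Both namings of the two indices are used. *)
have key p q x x' : p != q -> (p == u) || (p == v) -> (q == u) || (q == v) ->
    x \in mid -> x' \in mid -> c x = c y -> c x' = c y ->
    (r (e p) <= r (e q)) = (r x <= r x') ->
    (r (e q) <= r (e p)) = (r x' <= r x) ->
    sim e (upd (upd f p x) q x').
  move=> pq pp qq xM x'M cx cx' xx' x'x.
  have outE w : out w = (w != p) && (w != q).
    rewrite /out; case/orP: pp pq => /eqP ->; case/orP: qq => /eqP ->;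
    by rewrite ?eqxx // andbC.
  have cp : c (e p) = c y by case/orP: pp => /eqP ->.
  have cq : c (e q) = c y by case/orP: qq => /eqP ->.
  have epq w : out w -> c (e w) = c y ->
      (r (e w) < r (e p)) = (r (e w) < r (e u)) /\
      (r (e w) < r (e q)) = (r (e w) < r (e u)).
    move=> /andP[wu wv] cw; have a := adj w wu wv cw.
    by split; [case/orP: pp => /eqP -> | case/orP: qq => /eqP ->].
  have ne w w' : w != w' -> e w != e w' by apply: contra_neq; apply: einj.
  have cmp w p' x'' : out w -> x'' \in mid -> c x'' = c y -> c (e p') = c y ->
      w != p' -> c (e w) = c y ->
      (r (e w) < r (e p')) = (r (e w) < r (e u)) ->
      (r (e w) <= r (e p')) = (r (f w) <= r x'') /\
      (r (e p') <= r (e w)) = (r x'' <= r (f w)).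
    move=> wo xM'' cx'' cp' wp' cw ewp.
    have fx : (r (f w) < r x'') = (r (e w) < r (e p')).
      by rewrite (fs w x'') // ?cx'' ?cw.
    split; last by rewrite leqNgt [RHS]leqNgt fx.
    rewrite (ltA (eA w) (eA p')) ?ne ?cw ?cp' //.
    by rewrite (ltA (fA w wo) (midA xM'')) ?fM // fc // cw cx''.
  apply: sim_order => [//|w|w|w w'].
  - rewrite /upd; case: (eqVneq w q) => [_|wq]; first exact: midA.
    case: (eqVneq w p) => [_|wp]; first exact: midA.
    by apply: fA; rewrite outE wp.
  - rewrite /upd; case: (eqVneq w q) => [->|wq]; first by rewrite cq.
    case: (eqVneq w p) => [->|wp]; first by rewrite cp.
    by rewrite fc // outE wp.
  - rewrite /upd; case: (eqVneq w q) => [->|wq]; case: (eqVneq w' q) => [->|w'q];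
      rewrite ?leqnn //.
    + case: (eqVneq w' p) => [->|w'p] // cw.
      have o : out w' by rewrite outE w'p.
      have cw' : c (e w') = c y by rewrite -cw.
      by have [_ ->] := cmp w' q x' o x'M cx' cq w'q cw' (epq w' o cw').2.
    + case: (eqVneq w p) => [->|wp] // cw.
      have o : out w by rewrite outE wp.
      have cw' : c (e w) = c y by rewrite cw.
      by have [-> _] := cmp w q x' o x'M cx' cq wq cw' (epq w o cw').2.
    + case: (eqVneq w p) => [->|wp]; case: (eqVneq w' p) => [->|w'p] cw;
        rewrite ?leqnn //.
      * have o : out w' by rewrite outE w'p.
        have cw' : c (e w') = c y by rewrite -cw.
        by have [_ ->] := cmp w' p x o xM cx cp w'p cw' (epq w' o cw').1.
      * have o : out w by rewrite outE wp.
        have cw' : c (e w) = c y by rewrite cw.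
        by have [-> _] := cmp w p x o xM cx cp wp cw' (epq w o cw').1.
      * by apply: fe; rewrite ?outE ?wp ?w'p.
have S1 : sim e (upd (upd f u y) v z).
  apply: key; rewrite ?eqxx ?orbT //; first by rewrite (ltnW uv) (ltnW yz).
  by rewrite leqNgt uv leqNgt yz.
have S2 : sim (upd (upd f u y) v z) (upd (upd f u z) v y).
  by apply: tpyz => // w wu wv; have [|] := fE w; rewrite ?inE /out ?wu.
apply: sim_trans S1 _; apply: sim_trans S2 _; apply: sim_sym.
have vNu : v != u by rewrite eq_sym.
(* Transposing the indices turns the comparison [S3] into the missing link. *)
pose tau w := if w == u then v else if w == v then u else w.
have -> : upd (upd e u (e v)) v (e u) = e \o tau.
  apply: funext => w; rewrite /upd /= /tau.
  case: (eqVneq w v) => [->|wv]; first by rewrite (negbTE vNu).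
  by case: (eqVneq w u).
have -> : upd (upd f u z) v y = upd (upd f v z) u y \o tau.
  apply: funext => w; rewrite /upd /= /tau.
  case: (eqVneq w v) => [->|wv]; first by rewrite (negbTE vNu) eqxx.
  case: (eqVneq w u) => [_|wu]; first by rewrite !eqxx ?(negbTE vNu) ?(negbTE uNv) ?eqxx.
  by rewrite (negbTE wu) (negbTE wv).
have S3 : sim e (upd (upd f v z) u y).
  apply: key; rewrite ?eqxx ?orbT // 1?eq_sym //; first by rewrite leqNgt uv leqNgt yz.
  by rewrite (ltnW uv) (ltnW yz).
exact: sim_comp S3.
Qed.

(** Induction on the number of points of the family strictly between [e v] and [x] in the block:
    exchange [e v] with its upper neighbour by [transpose] and continue from there. *)
Lemma jump_up V (e : V -> T) v x y z :
  y \in mid -> z \in mid -> c y = c z -> r y < r z -> tp2 y z z y ->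
  #|V| <= m -> injective e -> (forall w, e w \in A) -> c (e v) = c y ->
  x \in block (c y) -> (forall w, e w != x) -> r (e v) < r x ->
  sim e (upd e v x).
Proof.
move=> yM zM cyz yz tpyz Vm einj eA cv /blockA[xA cx].
pose between e := [set w : V | (c (e w) == c y) && (r (e v) < r (e w) < r x)].
have [d] := ubnP #|between e|; elim: d e einj eA cv => // d IHd e einj eA cv.
rewrite ltnS => bd ex vx.
have ne w w' : w != w' -> e w != e w' by apply: contra_neq; apply: einj.
case: (set_0Vmem (between e)) => [b0|[w0 w0b]].
  have out w : w != v -> c (e w) = c y ->
      (r (e w) < r (e v)) = (r (e w) < r x).
    move=> wv cw; apply/idP/idP => [|wx]; first by move/ltn_trans; apply.
    rewrite ltnNge; apply/negP => vw; have : w \in between e.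
      by rewrite inE cw eqxx wx andbT -(ltA (eA v) (eA w)) ?cw // ne // eq_sym.
    by rewrite b0 inE.
  have outx w : w != v -> c (e w) = c y ->
      (r (e w) <= r (e v)) = (r (e w) <= r x).
    move=> wv cw; rewrite (ltA (eA w) (eA v)) ?cw ?ne //.
    by rewrite (ltA (eA w) xA) ?cw ?cx // out.
  apply: sim_order => [//|||u w]; first exact: updA.
    by move=> w; rewrite /upd; case: eqP => // ->; rewrite cv cx.
  rewrite /upd; case: (eqVneq u v) => [->|uv]; case: (eqVneq w v) => [->|wv] // cuw.
  - by rewrite !leqnn.
  - by rewrite leqNgt [RHS]leqNgt out // -cuw.
  - by rewrite outx // cuw.
case: (@arg_minnP _ w0 (mem (between e)) (r \o e) w0b) => w /= wb wmin.
move: (wb); rewrite inE => /and3P[/eqP cw vw wx].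
have wv : w != v by apply: contraTneq vw => ->; rewrite ltnn.
have vwN : v != w by rewrite eq_sym.
have adj w' : w' != v -> w' != w -> c (e w') = c y ->
    (r (e w') < r (e v)) = (r (e w') < r (e w)).
  move=> w'v w'w cw'; apply/idP/idP => [/ltn_trans|lt]; first by apply.
  rewrite ltnNge; apply/negP => le; have : w' \in between e.
    rewrite inE cw' eqxx (ltn_trans lt wx) andbT /=.
    by rewrite -(ltA (eA v) (eA w')) ?cw' // ne // eq_sym.
  by move/wmin; rewrite /= leqNgt lt.
pose e1 := upd (upd e v (e w)) w (e v).
have e1v : e1 v = e w by rewrite /e1 upd_other // upd_same.
have e1w : e1 w = e v by rewrite /e1 upd_same.
have e1o u : u != v -> u != w -> e1 u = e u by move=> uv uw; rewrite /e1 !upd_other.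
have e1P u : exists u', e1 u = e u'.
  rewrite /e1 /upd; case: (u == w); first by exists v.
  by case: (u == v); [exists w|exists u].
have e1inj : injective e1.
  move=> p q; rewrite /e1 /upd.
  case: (eqVneq p w) => [->|pw]; case: (eqVneq q w) => [->|qw] //.
  - case: (eqVneq q v) => [->|qv]; first by move/einj => /esym.
    by move/einj => vq; rewrite vq eqxx in qv.
  - case: (eqVneq p v) => [->|pv]; first by move/einj => /esym.
    by move/einj => pv'; rewrite pv' eqxx in pv.
  case: (eqVneq p v) => [->|pv]; case: (eqVneq q v) => [->|qv] //.
  - by move/einj => wq; rewrite wq eqxx in qw.
  - by move/einj => pw'; rewrite pw' eqxx in pw.
  - exact: einj.
have e1A u : e1 u \in A by have [u' ->] := e1P u.
have e1x u : e1 u != x by have [u' ->] := e1P u.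
have S1 : sim e e1 by apply: (transpose yM zM cyz yz tpyz).
apply: sim_trans S1 _.
have S2 : sim e1 (upd e1 v x).
  apply: IHd; rewrite ?e1v //.
  apply: leq_trans bd; apply: proper_card; apply/properP; split; last first.
    by exists w; rewrite // inE e1v e1w cv eqxx ltnNge ltnW.
  apply/fintype.subsetP => u; rewrite !inE e1v => /and3P[cu wu ux].
  have uv : u != v by apply: contraTneq wu => ->; rewrite e1v ltnn.
  have uw : u != w by apply: contraTneq wu => ->; rewrite e1w -leqNgt ltnW.
  by rewrite e1o // in cu wu ux; rewrite cu ux (ltn_trans vw wu).
apply: sim_trans S2 _.
(* The two families differ only at [w], where one takes [e v] and the other [e w]; none of their
   other points separates these two values. *)
have exA u : upd e v x u \in A by apply: updA.
apply: sim_order => [|//|u|p q]; first exact: updA.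
  rewrite /upd; case: (eqVneq u v) => // uv.
  by case: (eqVneq u w) => [->|uw]; [rewrite e1w cv cw|rewrite e1o].
have adjw u : u != v -> u != w -> c (e u) = c y ->
    (r (e v) <= r (e u)) = (r (e w) <= r (e u)) /\
    (r (e u) <= r (e v)) = (r (e u) <= r (e w)).
  move=> uv uw cu; split; first by rewrite leqNgt [RHS]leqNgt adj.
  rewrite (ltA (eA u) (eA v)) ?cu ?ne // (ltA (eA u) (eA w)) ?cu ?cw ?ne //.
  exact: adj.
rewrite /upd; case: (eqVneq p v) => [_|pv]; case: (eqVneq q v) => [_|qv];
  rewrite ?leqnn //.
- case: (eqVneq q w) => [->|qw]; last by rewrite e1o.
  by rewrite e1w leqNgt (ltn_trans vw wx) leqNgt wx.
- case: (eqVneq p w) => [->|pw]; last by rewrite e1o.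
  by rewrite e1w (ltnW wx) (ltnW (ltn_trans vw wx)).
- case: (eqVneq p w) => [->|pw]; case: (eqVneq q w) => [->|qw]; rewrite ?leqnn //.
  + rewrite e1w e1o // cv => cq.
    by have [-> _] := adjw q qv qw (esym cq).
  + by rewrite e1w e1o // cv => cp; have [_ ->] := adjw p pv pw cp.
  + by rewrite !e1o.
Qed.

(* Hence, on a block that is not symmetric, the order of middle points is definable
   from types over [ends]. *)
Lemma tp2_symmetric y z :
  y \in mid -> z \in mid -> c y = c z -> r y < r z -> tp2 y z z y ->
  symmetric_block (c y).
Proof.
move=> yM zM cyz yz tpyz V e v x Vm einj eA cv xB ex.
have [xA cx] := blockA xB.
have exA : forall w, upd e v x w \in A by apply: updA.
have exinj : injective (upd e v x) by apply: upd_inj => // w _; apply/eqP.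
have evx := ex v.
case: (ltnP (r (e v)) (r x)) => [vx|xv].
  exact: (jump_up yM zM cyz yz tpyz).
(* A downward move is an upward move read backwards. *)
apply: sim_sym; rewrite -{2}(upd_id e v) -(upd_upd e v x (e v)).
apply: (jump_up yM zM cyz yz tpyz) => //.
- by rewrite upd_same.
- by rewrite -cv in_block.
- move=> w; rewrite /upd; case: (eqVneq w v) => [_|wv]; first by rewrite eq_sym.
  by apply: contra_neq wv; apply: einj.
- by rewrite upd_same -(ltA xA (eA v)) ?cv // eq_sym.
Qed.

Definition exchangeable x y : Prop :=
  [/\ x \in A, y \in A, symmetric_block (c x), symmetric_block (c y) &
      c x = c y \/ exists x' y', [/\ x' \in mid, y' \in mid, c x' = c x,
        c y' = c y & tp1 x' y']].

Lemma exchange_sim V (e : V -> T) v x :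
  #|V| <= m -> injective e -> (forall w, e w \in A) ->
  exchangeable (e v) x -> (forall w, e w != x) -> sim e (upd e v x).
Proof.
move=> Vm einj eA [_ xA sym _ tpx] ex.
case: (eqVneq (c (e v)) (c x)) => cvx.
  by apply: sym => //; rewrite cvx in_block.
case: tpx => [/eqP|[y [y' [yM y'M cy cy' tpy]]]]; first by rewrite (negbTE cvx).
apply: (cross yM y'M) => //; first by rewrite cy cy'.
by rewrite cy' in_block.
Qed.

(** Points are moved to their targets one at a time. If the target [f v] is occupied by [e w0], that
    point first moves to a fresh point of its own block. *)
Lemma exchanges_sim V (e f : V -> T) :
  #|V| <= m -> injective e -> injective f ->
  (forall w, e w \in A) -> (forall w, f w \in A) ->
  (forall v, e v = f v \/
     exchangeable (e v) (f v) /\ 2 * m < #|block (c (e v))|) ->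
  sim e f.
Proof.
move=> Vm + finj + fA; pose D (e : V -> T) := [set v | e v != f v].
have [d] := ubnP #|D e|; elim: d e => // d IHd e; rewrite ltnS => De einj eA ef.
case: (set_0Vmem (D e)) => [D0|[v vD]].
  have -> : e = f.
    apply: funext => v; apply/eqP/negPn/negP => vD.
    have : v \in D e by rewrite inE.
    by rewrite D0 inE.
  exact: sim_refl.
have efv v' : v' \in D e -> exchangeable (e v') (f v') /\ 2 * m < #|block (c (e v'))|.
  by rewrite inE; case: (ef v') => // ->; rewrite eqxx.
have step (g : V -> T) : injective g -> (forall w, g w \in A) ->
    (forall w, w \in D e -> exchangeable (g w) (f w) /\ 2 * m < #|block (c (g w))|) ->
    (forall w, w \notin D e -> g w = f w) ->
    (forall w, g w != f v) -> sim g f.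
  move=> ginj gA gD gN gv; have [gfv groom] := gD v vD.
  apply: sim_trans (exchange_sim Vm ginj gA gfv gv) _.
  apply: IHd.
  - apply: leq_trans De; apply: proper_card; apply/properP; split; last first.
      by exists v; rewrite // inE upd_same eqxx.
    apply/fintype.subsetP => w; rewrite [in X in X -> _]inE /upd.
    case: (eqVneq w v) => [->|wv]; first by rewrite eqxx.
    by apply: contraR => /gN ->.
  - by apply: upd_inj => // w _; apply/eqP.
  - exact: updA.
  - move=> w; rewrite /upd; case: (eqVneq w v) => [->|wv]; first by left.
    by case: (boolP (w \in D e)) => wD; [right; apply: gD|left; apply: gN].
have [[w0 ew0]|free] := pselect (exists w, e w = f v); last first.
  apply: step => // [w|w].
    by rewrite inE negbK => /eqP.
  by apply/eqP => ew; apply: free; exists w.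
have w0D : w0 \in D e.
  rewrite inE; apply: contraTneq vD => ewf; rewrite inE negbK.
  by have -> : v = w0 by [apply: finj; rewrite -ew0 ewf]; rewrite ewf.
have [[ewA fwA sw sfw tpw] room] := efv w0 w0D.
have [|x xB xF] := @fresh (c (e w0)) ([set e w | w in V] :|: [set f w | w in V]).
  apply: leq_ltn_trans room; apply: leq_trans (leq_card_setU _ _) _.
  rewrite mul2n -addnn; apply: leq_add;
  by apply: leq_trans (leq_imset_card _ _) Vm.
have [xA cx] := blockA xB.
have ex w : e w != x by apply: contraNneq xF => <-; rewrite inE imset_f.
have fx w : f w != x by apply: contraNneq xF => <-; rewrite inE orbC imset_f.
have Sx : sim e (upd e w0 x).
  by apply: exchange_sim => //; split; rewrite ?cx //; left.
apply: sim_trans Sx _; apply: step.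
- by apply: upd_inj => // w _; apply/eqP.
- exact: updA.
- move=> w wD; rewrite /upd; case: (eqVneq w w0) => [->|ww0]; last exact: efv.
  by rewrite cx; split=> //; split; rewrite ?cx.
- move=> w wD; rewrite upd_other; first by move: wD; rewrite inE negbK => /eqP.
  by apply: contraNneq wD => ->.
- move=> w; rewrite /upd; case: (eqVneq w w0) => [_|ww0]; first by rewrite eq_sym.
  by rewrite -ew0; apply: contra_neq ww0; apply: einj.
Qed.

(** From [e] to the intermediate family [g] only points of non-symmetric blocks move, keeping their
    colour, by [cross_symmetric], and their order; from [g] to [f] points of symmetric blocks are
    exchanged. *)
Lemma types_sim V (e f : V -> T) :
  #|V| <= m -> injective e -> injective f ->
  (forall w, e w \in A) -> (forall w, f w \in A) ->
  (forall v, e v = f v \/ [/\ e v \in mid, f v \in mid & tp1 (e v) (f v)]) ->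
  (forall u v, c (e u) = c (e v) -> ~ symmetric_block (c (e u)) ->
     (r (e u) <= r (e v)) = (r (f u) <= r (f v))) ->
  sim e f.
Proof.
move=> Vm einj finj eA fA ef er.
have nsym v : ~ symmetric_block (c (e v)) -> c (f v) = c (e v).
  move=> ns; case: (ef v) => [->//|[eM fM tp]]; apply/eqP/negPn/negP => ne.
  by apply: ns; apply: (cross_symmetric eM fM _ tp); rewrite eq_sym.
have fsym v : symmetric_block (c (e v)) -> symmetric_block (c (f v)).
  move=> s; case: (eqVneq (c (e v)) (c (f v))) => [<-//|ne].
  case: (ef v) => [ev|[eM fM tp]]; first by rewrite ev eqxx in ne.
  by apply: (cross_symmetric fM eM); [rewrite eq_sym|apply: tp1_sym].
pose g v := if `[< symmetric_block (c (e v)) >] then e v else f v.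
have gs v : symmetric_block (c (e v)) -> g v = e v by move=> s; rewrite /g asboolT.
have gn v : ~ symmetric_block (c (e v)) -> g v = f v by move=> s; rewrite /g asboolF.
have gc v : c (g v) = c (e v).
  have [s|s] := pselect (symmetric_block (c (e v))); first by rewrite gs.
  by rewrite gn // nsym.
have gA v : g v \in A by rewrite /g; case: ifP.
have ginj : injective g.
  move=> u v guv; have cuv : c (e u) = c (e v) by rewrite -!gc guv.
  have [s|s] := pselect (symmetric_block (c (e u))).
    by apply: einj; rewrite -gs // guv gs // -cuv.
  by apply: finj; rewrite -gn // guv gn // -cuv.
apply: (@sim_trans _ _ _ _ _ _ g).
  apply: sim_order => // u v cuv.
  have [s|s] := pselect (symmetric_block (c (e u))).
    by rewrite !gs // -cuv.
  by rewrite !gn -?cuv // er.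
apply: exchanges_sim => // v.
have [s|s] := pselect (symmetric_block (c (e v))); last by left; apply: gn.
rewrite gs //; case: (ef v) => [->|[eM fM tp]]; first by left.
right; split; last exact: mid_room.
by split; rewrite ?midA //; [exact: fsym|right; exists (e v), (f v)].
Qed.

(** A point of [ends] is among the first [m] or the last [m] of its block, so all middle points of
    the block are on the same side of it. *)
Lemma ends_order x y y' :
  x \in ends -> y \in mid -> y' \in mid -> c y = c x -> c y' = c x ->
  (r x <= r y) = (r x <= r y') /\ (r y <= r x) = (r y' <= r x).
Proof.
move=> xE yM y'M cy cy'; have xA := endsA xE.
have xB := in_block xA.
have yB : y \in block (c x) by rewrite -cy in_block // midA.
have y'B : y' \in block (c x) by rewrite -cy' in_block // midA.
move: xE yM y'M; rewrite !inE xA /= andbT => xE /and3P[yA ly hy] /and3P[y'A ly' hy'].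
move: ly hy ly' hy' xE; rewrite /lo /hi cy cy' negb_and -!ltnNge => ly hy ly' hy'.
have := below_leE rev xB yB; have := below_leE rev xB y'B.
have := below_leE rev yB xB; have := below_leE rev y'B xB.
have := below_leE r xB yB; have := below_leE r xB y'B.
have := below_leE r yB xB; have := below_leE r y'B xB.
by rewrite !rev_le; lia.
Qed.

(** If two pairs of equal type were oppositely ordered, the second would have over [ends] the order
    pattern of the first one reversed; so the first would satisfy [tp2 u v v u] and its block would
    be symmetric. *)
Lemma tp2_order x y x' y' :
  x \in mid -> y \in mid -> x' \in mid -> y' \in mid ->
  c y = c x -> c x' = c x -> c y' = c x -> ~ symmetric_block (c x) ->
  x != y -> x' != y' -> tp2 x y x' y' -> (r x <= r y) = (r x' <= r y').
Proof.
have main u v u' v' : u \in mid -> v \in mid -> u' \in mid -> v' \in mid ->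
    c v = c u -> c u' = c u -> c v' = c u -> ~ symmetric_block (c u) ->
    tp2 u v u' v' -> r u < r v -> r v' < r u' -> False.
  move=> uM vM u'M v'M cv cu' cv' ns tp uv vu'.
  apply: ns; apply: (tp2_symmetric uM vM) => // V e p q Vm pq eE.
  apply: sim_trans (tp V e p q Vm pq eE) _.
  have eA w : w != p -> w != q -> e w \in A by move=> wp wq; apply: endsA; apply: eE.
  have emid w z z' : w != p -> w != q -> z \in mid -> z' \in mid -> c z = c z' ->
      c (e w) = c z -> (r (e w) <= r z) = (r (e w) <= r z') /\
                       (r z <= r (e w)) = (r z' <= r (e w)).
    by move=> wp wq zM z'M czz' cw; apply: ends_order; rewrite ?eE // -?czz' cw.
  apply: sim_order => [w|w|w|w w']; rewrite /upd.
  - case: (eqVneq w q) => [_|wq]; first exact: midA.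
    by case: (eqVneq w p) => [_|wp]; [exact: midA|exact: eA].
  - case: (eqVneq w q) => [_|wq]; first exact: midA.
    by case: (eqVneq w p) => [_|wp]; [exact: midA|exact: eA].
  - by case: (eqVneq w q) => [_|wq]; [|case: (eqVneq w p) => [_|wp]];
      rewrite // ?cu' ?cv' ?cv.
  case: (eqVneq w q) => [_|wq]; case: (eqVneq w' q) => [_|w'q]; rewrite ?leqnn //.
  - case: (eqVneq w' p) => [_|w'p] ce; first by rewrite (ltnW uv) (ltnW vu').
    by have [] := emid w' v' u w'p w'q v'M uM cv' (esym ce).
  - case: (eqVneq w p) => [_|wp] ce; first by rewrite leqNgt vu' leqNgt uv.
    by have [] := emid w v' u wp wq v'M uM cv' ce.
  case: (eqVneq w p) => [_|wp]; case: (eqVneq w' p) => [_|w'p] ce; rewrite ?leqnn //.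
  - by have [] := emid w' u' v w'p w'q u'M vM (etrans cu' (esym cv)) (esym ce).
  - by have [] := emid w u' v wp wq u'M vM (etrans cu' (esym cv)) ce.
move=> xM yM x'M y'M cy cx' cy' ns xy xy' tp.
have tp' : tp2 y x y' x'.
  move=> V e u v Vm uv eE.
  have C (a b : T) : upd (upd e u a) v b = upd (upd e v b) u a.
    apply: funext => w; rewrite /upd; case: (eqVneq w v) => // ->.
    by rewrite eq_sym (negbTE uv).
  rewrite (C y x) (C y' x'); apply: tp => //; first by rewrite eq_sym.
  by move=> w wv wu; apply: eE.
rewrite (ltA (midA xM) (midA yM)) // (ltA (midA x'M) (midA y'M)) ?cx' ?cy' //.
apply/idP/idP => [lt|lt]; rewrite ltnNge; apply/negP => le.
  apply: (main x y x' y') => //.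
  by rewrite -(ltA (midA y'M) (midA x'M)) ?cx' ?cy' // eq_sym.
apply: (main y x y' x'); rewrite ?cy //.
by rewrite -(ltA (midA yM) (midA xM)) ?cy // eq_sym.
Qed.

End Blocks.

(** * One-point extensions *)

Section OnePoint.
Variables (I : Type) (mu : I -> nat) (T : finType).
Variable rho : forall i, (mu i).-tuple T -> Prop.
Variables (m N : nat).
Hypothesis mu_le : forall i, mu i <= m.
Implicit Types (V : finType) (x y z : T).

(** This is [good] for the structure induced on [A]; colours and ranks remain total on [T], which
    avoids subtypes. *)
Definition good_on (K : Type) (A : {set T}) (c : T -> K) (r : T -> nat) : Prop :=
  (forall x y, x \in A -> y \in A -> c x = c y -> r x = r y -> x = y) /\
  (forall i (t t' : (mu i).-tuple T),
     (forall a, tnth t a \in A) -> (forall a, tnth t' a \in A) ->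
     (forall a, c (tnth t a) = c (tnth t' a)) ->
     (forall a b, c (tnth t a) = c (tnth t b) ->
        (r (tnth t a) <= r (tnth t b)) = (r (tnth t' a) <= r (tnth t' b))) ->
     (rho t <-> rho t')).

(** Indexing by the distinct entries of a tuple reduces tuples with repetitions to injective
    families of at most [m] points. *)
Lemma compatible_sim (K : Type) (c : T -> K) (r : T -> nat) :
  separating c r ->
  (forall V (e f : V -> T), #|V| <= m -> injective e -> injective f ->
     (forall v, c (e v) = c (f v)) ->
     (forall u v, c (e u) = c (e v) -> (r (e u) <= r (e v)) = (r (f u) <= r (f v))) ->
     sim rho e f) ->
  compatible rho c r rho c r.
Proof.
move=> sep sims i t t' tc tr.
pose V : finType := {x : T | x \in tval t}.
have Vm : #|V| <= m.
  rewrite card_sig; apply: leq_trans (mu_le i).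
  by have := card_size (tval t); rewrite size_tuple.
have pre (v : V) : exists a, tnth t a = val v.
  by case: v => x xt /=; have /tnthP[a ->] := xt; exists a.
have [g gP] := choice pre.
pose f v := tnth t' (g v).
have fc v : c (val v) = c (f v) by rewrite -gP tc.
have fr u v : c (val u) = c (val v) ->
    (r (val u) <= r (val v)) = (r (f u) <= r (f v)).
  by rewrite -!gP; apply: tr.
have finj : injective f.
  move=> u v fuv; have cuv : c (val u) = c (val v) by rewrite !fc fuv.
  apply: val_inj; apply: sep => //; apply/eqP; rewrite eqn_leq.
  by rewrite !fr // fuv leqnn.
pose s := [tuple (exist _ (tnth t a) (mem_tnth a t) : V) | a < mu i].
have := sims V val f Vm val_inj finj fc fr i s.
have -> : map_tuple val s = t.
  by apply: eq_from_tnth => a; rewrite tnth_map tnth_mktuple.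
suff -> : map_tuple f s = t' by [].
apply: eq_from_tnth => a; rewrite tnth_map tnth_mktuple /f; set v : V := exist _ _ _.
have ga : tnth t (g v) = tnth t a by rewrite gP.
apply: sep; first by rewrite -!tc ga.
by apply/eqP; rewrite eqn_leq -!tr ?ga // leqnn.
Qed.

(** Bounds [m] deleted points plus the ends of [m] deletions, at most [2 * m * N] each. *)
Let s0 := m + m * (2 * m * N).

(** Counts the colours of [refined_colour]: one for each distinguished point, and for the others an
    old colour, the size of a gap and [m] bits. *)
Definition one_point_bound : nat :=
  #|(('I_s0.+1 + 'I_N * 'I_s0.+1 * {ffun 'I_m -> bool})%type : finType)|.

Hypothesis deletions : forall a : T, exists (c : T -> 'I_N) (r : T -> nat),
  good_on (~: [set a]) c r.

(** * Refining the colouring of one deletion by comparison with [m] others *)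

Section Refinement.
Variables (a : 'I_m -> T) (ck : 'I_m -> T -> 'I_N) (rk : 'I_m -> T -> nat).
Hypothesis a_inj : injective a.
Let A k := ~: [set a k].
Hypothesis goodk : forall k, good_on (A k) (ck k) (rk k).
Let midk k := mid m (A k) (ck k) (rk k).
Let endsk k := ends m (A k) (ck k) (rk k).
Let symk k := symmetric_block rho m (A k) (ck k).
Let tp1k k := tp1 rho m (A k) (ck k) (rk k).
Let tp2k k := tp2 rho m (A k) (ck k) (rk k).
Let S0 := [set a k | k in 'I_m] :|: \bigcup_k endsk k.

Lemma card_S0 : #|S0| <= s0.
Proof.
apply: leq_trans (leq_card_setU _ _) _; apply: leq_add.
  by apply: leq_trans (leq_imset_card _ _) _; rewrite card_ord.
have le (J : seq 'I_m) : #|\bigcup_(k <- J) endsk k| <= \sum_(k <- J) #|endsk k|.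
  elim: J => [|k J IHJ]; first by rewrite !big_nil cards0.
  rewrite !big_cons; apply: leq_trans (leq_card_setU _ _) _.
  by rewrite leq_add2l.
apply: leq_trans (le _) _.
apply: (@leq_trans (\sum_(k < m) 2 * m * N)); last by rewrite sum_nat_const card_ord.
by apply: leq_sum => k _; have := card_ends m (goodk k).1; rewrite card_ord.
Qed.

Variables (star : T) (c : T -> 'I_N) (r : T -> nat).
Hypothesis starN : star \notin S0.
Hypothesis goods : good_on (~: [set star]) c r.
Let S := star |: S0.

Lemma S0_star x : x \in S0 -> x != star.
Proof. by apply: contraTneq => ->. Qed.

Lemma ends_S0 k x : x \in endsk k -> x \in S0.
Proof. by move=> xE; rewrite inE; apply/orP; right; apply/bigcupP; exists k. Qed.

Lemma notin_S x : x \notin S -> x != star /\ x \notin S0.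
Proof. by rewrite !inE !negb_or => /andP[]. Qed.

Lemma mid_of k x : x != a k -> x \notin endsk k -> x \in midk k.
Proof.
move=> xa; rewrite finset.in_setD negb_and negbK => /orP[//|].
by rewrite !inE xa.
Qed.

Lemma mid_notin k x : x \notin S -> x \in midk k.
Proof.
move=> /notin_S[_ xS0]; apply: mid_of.
  by apply: contraNneq xS0 => ->; rewrite inE imset_f.
by apply: contra xS0; apply: ends_S0.
Qed.

(** Seen from [(c, r)], the two points occupy the same place relative to [S0], which contains the
    ends of the deletions of all the [a k]. *)
Definition near x y : Prop := [/\ x != star, y != star, c x = c y &
  forall p, p \in S0 -> c p = c x ->
    (r p <= r x) = (r p <= r y) /\ (r x <= r p) = (r y <= r p)].

Lemma near_refl x : x != star -> near x x.
Proof. by []. Qed.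

Lemma near_sym x y : near x y -> near y x.
Proof.
move=> [xs ys cxy pxy]; split=> // p pS cp.
by have [||-> ->] := pxy p; rewrite ?cxy.
Qed.

(** The ends of the deletion of [a k] lie in [S0], away from [star], so [(c, r)] decides the
    relations involved. This transfers information from [(c, r)] to each [(ck k, rk k)]. *)
Lemma near_tp2 k x y x' y' : near x x' -> near y y' ->
  (c x = c y -> (r x <= r y) = (r x' <= r y') /\ (r y <= r x) = (r y' <= r x')) ->
  tp2k k x y x' y'.
Proof.
move=> [xs x's cx px] [ys y's cy py] xy V e u v Vm uv eE.
have eS0 w : w != u -> w != v -> e w \in S0.
  by move=> wu wv; apply: (@ends_S0 k); apply: eE.
have es w : w != u -> w != v -> e w \in ~: [set star].
  by move=> wu wv; rewrite !inE S0_star // eS0.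
apply: (sim_order goods.2) => [w|w|w|w w']; rewrite /upd.
- case: (eqVneq w v) => [_|wv]; first by rewrite !inE.
  by case: (eqVneq w u) => [_|wu]; [rewrite !inE|apply: es].
- case: (eqVneq w v) => [_|wv]; first by rewrite !inE.
  by case: (eqVneq w u) => [_|wu]; [rewrite !inE|apply: es].
- by case: (eqVneq w v) => // _; case: (eqVneq w u).
case: (eqVneq w v) => [_|wv]; case: (eqVneq w' v) => [_|w'v]; rewrite ?leqnn //.
- case: (eqVneq w' u) => [_|w'u] ce; first by have [] := xy (esym ce).
  by have [] := py (e w') (eS0 w' w'u w'v) (esym ce).
- case: (eqVneq w u) => [_|wu] ce; first by have [] := xy ce.
  by have [] := py (e w) (eS0 w wu wv) ce.
case: (eqVneq w u) => [_|wu]; case: (eqVneq w' u) => [_|w'u] ce; rewrite ?leqnn //.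
- by have [] := px (e w') (eS0 w' w'u w'v) (esym ce).
- by have [] := px (e w) (eS0 w wu wv) ce.
Qed.

Lemma near_tp1 k x y : near x y -> tp1k k x y.
Proof.
move=> [xs ys cx px] V e v Vm eE.
have eS0 w : w != v -> e w \in S0.
  by move=> wv; apply: (@ends_S0 k); apply: eE.
have es w : w != v -> e w \in ~: [set star].
  by move=> wv; rewrite !inE S0_star // eS0.
apply: (sim_order goods.2) => [w|w|w|w w']; rewrite /upd.
- by case: (eqVneq w v) => [_|wv]; [rewrite !inE|apply: es].
- by case: (eqVneq w v) => [_|wv]; [rewrite !inE|apply: es].
- by case: (eqVneq w v).
case: (eqVneq w v) => [_|wv]; case: (eqVneq w' v) => [_|w'v] ce; rewrite ?leqnn //.
- by have [] := px (e w') (eS0 w' w'v) (esym ce).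
- by have [] := px (e w) (eS0 w wv) ce.
Qed.

Lemma near_block k x y : near x y -> x \in midk k -> y \in midk k ->
  ~ symk k (ck k x) -> ck k y = ck k x.
Proof.
move=> xy xM yM ns; apply/eqP/negPn/negP => ne; apply: ns.
apply: (cross_symmetric (goodk k).1 (goodk k).2 xM yM); first by rewrite eq_sym.
exact: near_tp1.
Qed.

Definition gap x : {set T} := [set p in S0 | (c p == c x) && (r p <= r x)].

Lemma in_gap p x : (p \in gap x) = [&& p \in S0, c p == c x & r p <= r x].
Proof. by rewrite finset.in_set. Qed.

Lemma gap_near x y : x \notin S -> y \notin S -> c x = c y -> gap x = gap y -> near x y.
Proof.
move=> xS yS cxy /finset.setP gxy.
have [xs xS0] := notin_S xS; have [ys yS0] := notin_S yS.
split=> // p pS cp; have := gxy p; rewrite !in_gap pS -cxy cp eqxx /= => e.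
have pA : p \in ~: [set star] by rewrite !inE S0_star.
have ne z : z \notin S0 -> p != z by apply: contraNneq => <-.
split=> //.
rewrite (ltA goods.1 _ pA) ?inE // 1?eq_sym ?ne // [RHS](ltA goods.1 _ pA) ?inE //;
  rewrite ?cp ?cxy // 1?eq_sym ?ne //.
by rewrite !ltnNge e.
Qed.

(** Gaps of one colour are nested, so a number suffices to record one. *)
Lemma card_gap x y : c x = c y -> #|gap x| = #|gap y| -> gap x = gap y.
Proof.
move=> cxy cg; have sub u v : c u = c v -> r u <= r v -> gap u \subset gap v.
  move=> cuv uv; apply/fintype.subsetP => p; rewrite !in_gap cuv => /and3P[-> -> /=].
  by move/leq_trans; apply.
case: (leqP (r x) (r y)) => [|/ltnW] xy; apply/eqP.
  by rewrite eqEcard sub //= cg.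
by rewrite eq_sym eqEcard sub //= cg.
Qed.

Definition bits x : {ffun 'I_m -> bool} :=
  [ffun k => [&& `[< ~ symk k (ck k star) >], ck k x == ck k star &
                 rk k x <= rk k star]].

(* Every point of [S] gets its own colour. Elsewhere [bits] records the position
   with respect to [star], which the structure outside [star] cannot see. *)
Definition refined_colour x : 'I_s0.+1 + 'I_N * 'I_s0.+1 * {ffun 'I_m -> bool} :=
  if x \in S then inl (inord (index x (enum S)))
  else inr (c x, inord #|gap x|, bits x).

Lemma refined_colourP x y : refined_colour x = refined_colour y ->
  x = y \/ [/\ x \notin S, y \notin S, near x y & bits x = bits y].
Proof.
have cS : #|S| <= s0.+1.
  by rewrite cardsU1 starN; have := card_S0; lia.
rewrite /refined_colour; case: ifPn => xS; case: ifPn => yS //.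
  case=> /(congr1 val); have ix z : z \in S -> index z (enum S) < s0.+1.
    by move=> zS; apply: leq_trans cS; rewrite cardE index_mem mem_enum.
  rewrite /= !inordK ?ix // => ixy; left.
  by rewrite -(nth_index x (s := enum S) (x := x)) ?mem_enum // ixy nth_index ?mem_enum.
case=> cxy /(congr1 val) gxy bxy; right; split=> //; apply: gap_near => //.
apply: card_gap => //; move: gxy.
have gs z : #|gap z| < s0.+1.
  rewrite ltnS; apply: leq_trans card_S0; apply: subset_leq_card.
  by apply/fintype.subsetP => p; rewrite in_gap => /andP[].
by rewrite /= !inordK ?gs.
Qed.

Lemma refined_separating : separating refined_colour r.
Proof.
move=> x y /refined_colourP[//|[xS yS [xs ys cxy _] _]].
by apply: goods.1 => //; rewrite !inE.
Qed.

Lemma near_trans x y z : near x y -> near y z -> near x z.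
Proof.
move=> [xs ys cxy pxy] [_ zs cyz pyz]; split=> //; first by rewrite cxy.
move=> p pS cp; have [-> ->] := pxy p pS cp.
by apply: pyz; rewrite -?cxy.
Qed.

Lemma neq_near x y : x \notin S -> near x y -> y \notin S -> x != y ->
  (r x <= r y) = (r x < r y).
Proof. by move=> xS [xs ys cxy _] yS xy; apply: (ltA goods.1); rewrite ?inE. Qed.

(** Some point of [S0] separates [x] from [y], and by nearness it separates [x'] from [y']. *)
Lemma gap_lt x y x' y' : near x x' -> near y y' -> c x = c y ->
  gap x != gap y -> r x <= r y -> r x' < r y'.
Proof.
move=> [_ _ _ px] [_ _ _ py] cxy; rewrite finset.eqEsubset negb_and => /orP[|].
  case/fintype.subsetPn => p; rewrite !in_gap cxy => /and3P[-> -> /= px'] /negP npy xy.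
  by case: npy; apply: leq_trans xy.
case/fintype.subsetPn => p; rewrite !in_gap cxy => /and3P[pS /eqP cp pY].
rewrite pS cp eqxx /= => npx _.
have [e1 _] := px p pS (etrans cp (esym cxy)); have [e2 _] := py p pS cp.
by rewrite e1 -ltnNge in npx; rewrite e2 in pY; apply: leq_trans pY.
Qed.

(** The differing bit says that [star] separates [x] from [y] in the order [rk k], and [x'] from
    [y'] in the same direction. If [r] ordered the two pairs oppositely, [near_tp2] would give
    [(x, y)] and [(y', x')] the same type, against [tp2_order]. *)
Lemma bits_order k x y x' y' :
  x \notin S -> y \notin S -> x' \notin S -> y' \notin S ->
  near x y -> near x x' -> near y y' -> bits x = bits x' -> bits y = bits y' ->
  bits x k -> ~~ bits y k ->
  (r x <= r y) = (r x' <= r y') /\ (r y <= r x) = (r y' <= r x').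
Proof.
move=> xS yS x'S y'S xy xx' yy' bx by_ bxk byk.
have x'y' : near x' y' by apply: near_trans (near_sym xx') (near_trans xy yy').
have main u v : u \notin S -> v \notin S -> near u v -> bits u k -> ~~ bits v k ->
    [/\ ~ symk k (ck k star), ck k u = ck k star, ck k v = ck k star &
        rk k u < rk k v].
  move=> uS vS uv; rewrite !ffunE => /and3P[/asboolP ns /eqP cu us].
  have cv : ck k v = ck k u.
    by apply: near_block; rewrite ?mid_notin // cu.
  rewrite asboolT // cv cu eqxx /= -ltnNge => sv; split=> //.
  exact: leq_ltn_trans sv.
have [ns cx cy xyk] := main x y xS yS xy bxk byk.
have [|| _ cx' cy' x'y'k] := main x' y' x'S y'S x'y'; rewrite -?bx -?by_ //.
have neq : x != y by apply: contraNneq byk => <-.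
have neq' : x' != y' by apply: contraNneq byk => e; rewrite by_ -e -bx.
have lt1 := neq_near xS xy yS neq.
have lt2 := neq_near x'S x'y' y'S neq'.
suff e : (r x <= r y) = (r x' <= r y').
  by split=> //; rewrite leqNgt -lt1 e lt2 -leqNgt.
apply: contraTeq xyk => ne; rewrite -leqNgt.
have e2 : (r x <= r y) = (r y' <= r x').
  by rewrite [RHS]leqNgt -lt2; move: ne; case: (r x <= r y); case: (r x' <= r y').
have e3 : (r y <= r x) = (r x' <= r y').
  by rewrite leqNgt -lt1; move: ne; case: (r x <= r y); case: (r x' <= r y').
have tp : tp2k k x y y' x'.
  apply: near_tp2 => //; first exact: near_trans yy'.
  exact: near_trans (near_sym xy) xx'.
have nsx : ~ symk k (ck k x) by rewrite cx.
have neq'' : y' != x' by rewrite eq_sym.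
have e := tp2_order (goodk k).1 (goodk k).2 (mid_notin k xS) (mid_notin k yS)
  (mid_notin k y'S) (mid_notin k x'S) (etrans cy (esym cx)) (etrans cy' (esym cx))
  (etrans cx' (esym cx)) nsx neq neq'' tp.
by rewrite leqNgt; apply/negP => /ltnW; rewrite e leqNgt x'y'k.
Qed.

(** Points of [S0] are fixed, and they separate points with distinct gaps. For a common gap,
    distinct bits are handled by [bits_order]; otherwise the refined colours are equal and the
    hypothesis applies. *)
Lemma refined_order V (e f : V -> T) :
  (forall v, refined_colour (e v) = refined_colour (f v)) ->
  (forall u v, refined_colour (e u) = refined_colour (e v) ->
     (r (e u) <= r (e v)) = (r (f u) <= r (f v))) ->
  forall u v, e u != star -> e v != star -> c (e u) = c (e v) ->
     (r (e u) <= r (e v)) = (r (f u) <= r (f v)).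
Proof.
move=> ef er u v us vs cuv.
have inS0 w : e w \in S0 -> f w = e w.
  move=> wS; have [//|[]] := refined_colourP (ef w).
  by move/notin_S => [_]; rewrite wS.
have nS w : e w != star -> e w \notin S0 ->
    [/\ e w \notin S, f w \notin S, near (e w) (f w) & bits (e w) = bits (f w)].
  move=> ws wS0; have wS : e w \notin S by rewrite in_setU1 negb_or ws.
  by have [<-|[]] := refined_colourP (ef w).
have [uS|uS] := boolP (e u \in S0); have [vS|vS] := boolP (e v \in S0).
- by rewrite !inS0.
- have [_ _ [_ _ _ pv] _] := nS v vs vS.
  by rewrite (inS0 u) //; have [] := pv (e u) uS cuv.
- have [_ _ [_ _ _ pu] _] := nS u us uS.
  by rewrite (inS0 v) //; have [] := pu (e v) vS (esym cuv).
have [uS' fuS nu bu] := nS u us uS; have [vS' fvS nv bv] := nS v vs vS.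
have [gE|gN] := eqVneq (gap (e u)) (gap (e v)); last first.
  case: leqP => uv; first by rewrite ltnW // (gap_lt nu nv cuv).
  apply/esym/negbTE; rewrite -ltnNge.
  by rewrite (gap_lt nv nu (esym cuv) _ (ltnW uv)) // eq_sym.
have nuv := gap_near uS' vS' cuv gE.
have [bE|bN] := eqVneq (bits (e u)) (bits (e v)).
  by apply: er; rewrite /refined_colour (negbTE uS') (negbTE vS') cuv gE bE.
have [k bk] : exists k, bits (e u) k != bits (e v) k.
  apply/existsP; rewrite -negb_forall; apply: contraNN bN => /forallP bE.
  by apply/eqP/ffunP => k; apply/eqP.
case buk: (bits (e u) k) bk; case bvk: (bits (e v) k) => // _.
  have [|->//] := @bits_order k (e u) (e v) (f u) (f v)
    uS' vS' fuS fvS nuv nu nv bu bv buk.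
  by rewrite bvk.
have [|_ ->//] := @bits_order k (e v) (e u) (f v) (f u)
  vS' uS' fvS fuS (near_sym nuv) nv nu bv bu bvk.
by rewrite buk.
Qed.

(* At most [m] points cannot contain [star] and all the [a k]: the relations between
   them are controlled either by [(c, r)] or by some [(ck k, rk k)]. *)
Lemma refined_compatible : compatible rho refined_colour r rho refined_colour r.
Proof.
apply: compatible_sim refined_separating _ => V e f Vm einj finj ef er.
have ord := refined_order ef er.
have fstar v : e v != star -> f v != star.
  by have [<-|[_ _ [_ ? _ _] _]] := refined_colourP (ef v).
have starE v : e v = star -> f v = star.
  move=> ev; have [<-//|[]] := refined_colourP (ef v).
  by rewrite ev in_setU1 eqxx.
have [[v0 ev0]|nostar] := pselect (exists v, e v = star); last first.
  have es v : e v != star by apply/eqP => ev; apply: nostar; exists v.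
  apply: (sim_order goods.2) => [v|v|v|u v cuv]; rewrite ?inE ?es ?fstar //.
    by have [->|[_ _ [] //]] := refined_colourP (ef v).
  exact: ord.
have [k ek] : exists k, forall v, e v != a k.
  apply/not_existsP => all.
  have pre k : exists v, e v = a k.
    have /existsNP[v /negP/negPn/eqP ev] := all k; by exists v.
  have [g gP] := choice pre.
  (* [Some k] stands for [a k] and [None] for [star]: these would be [m + 1] distinct points among
     at most [m]. *)
  have ginj : injective (fun o : option 'I_m => if o is Some k then g k else v0).
    have astar k : a k != star by apply: S0_star; rewrite inE imset_f.
    case=> [k|] [l|] //=.
    - by move=> gkl; congr Some; apply: a_inj; rewrite -!gP gkl.
    - by move=> gk; have := astar k; rewrite -gP gk ev0 eqxx.
    - by move=> gl; have := astar l; rewrite -gP -gl ev0 eqxx.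
  have := leq_card _ ginj; rewrite card_option card_ord => /leq_trans/(_ Vm).
  by rewrite ltnn.
have fk v : f v != a k.
  have [<-//|[_ + _ _]] := refined_colourP (ef v).
  by move/notin_S => [_]; apply: contraNneq => ->; rewrite inE imset_f.
have midE v : e v <> f v -> [/\ e v \in midk k, f v \in midk k, near (e v) (f v),
    bits (e v) = bits (f v) & e v \notin S].
  by move=> ne; have [//|[? ? ? ?]] := refined_colourP (ef v); split; rewrite ?mid_notin.
have eqv v : e v = f v \/ e v <> f v by apply: EM.
apply: (types_sim (goodk k).1 (goodk k).2 Vm) => // [v|v|v|u v cuv ns].
- by rewrite !inE.
- by rewrite !inE.
- have [evv|/midE[eM fM nw _ _]] := eqv v; first by left.
  by right; split; [exact: eM|exact: fM|exact: (@near_tp1 k _ _ nw)].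
have [<-|uv] := eqVneq u v; first by rewrite !leqnn.
have blk w : ck k (e w) = ck k (e u) -> ck k (f w) = ck k (e u).
  move=> cw; have [<-//|/midE[eM fM nw _ _]] := eqv w.
  by rewrite -cw; apply: near_block; rewrite ?cw.
have Ak w : e w \in A k by rewrite !inE.
have Fk w : f w \in A k by rewrite !inE.
have euv : e u != e v by apply: contra_neq uv; apply: einj.
have fuv : f u != f v by apply: contra_neq uv; apply: finj.
have starS : star \in S by rewrite in_setU1 eqxx.
(* Comparison with [star] in a non-symmetric block is what [bits] records. *)
have star_order w w' : e w = star -> ck k (e w) = ck k (e u) ->
    ck k (e w') = ck k (e u) -> w != w' ->
    (rk k (e w') <= rk k (e w)) = (rk k (f w') <= rk k (f w)).
  move=> ew cw cw' ww'; have fw := starE _ ew.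
  have [->|/midE[_ _ _ /ffunP/(_ k) + _]] := eqv w'; first by rewrite ew fw.
  by rewrite !ffunE -ew cw cw' blk // eqxx asboolT //= fw ew.
have nearw w : e w != star -> near (e w) (f w).
  by move=> ws; have [<-|/midE[]//] := eqv w; apply: near_refl.
have midw w : e w \notin endsk k -> e w \in midk k /\ f w \in midk k.
  move=> wN; have [<-|/midE[]//] := eqv w.
  by split; apply: mid_of => //.
have [us|us] := eqVneq (e u) star.
  rewrite (ltA (goodk k).1) // [RHS](ltA (goodk k).1) ?blk //.
  by rewrite !ltnNge star_order // -cuv.
have [vs|vs] := eqVneq (e v) star; first by apply: star_order; rewrite // eq_sym.
have fixS0 w : e w \in endsk k -> f w = e w.
  move=> /ends_S0 wS; have [//|/midE[_ _ _ _ /notin_S[_]]] := eqv w.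
  by rewrite wS.
have [uE|uM] := boolP (e u \in endsk k).
  rewrite (fixS0 u) //; have [vE|vM] := boolP (e v \in endsk k).
    by rewrite (fixS0 v).
  have [evM fvM] := midw v vM.
  by have [] := ends_order uE evM fvM (esym cuv) (blk v (esym cuv)).
have [euM fuM] := midw u uM.
have [vE|vM] := boolP (e v \in endsk k).
  rewrite (fixS0 v) //.
  by have [] := ends_order vE euM fuM cuv (etrans (blk u erefl) cuv).
have [evM fvM] := midw v vM.
(* For two middle points other than [star], [(c, r)] gives both pairs the same type, which
   determines their order in [rk k]. *)
have tp : tp2k k (e u) (e v) (f u) (f v).
  apply: near_tp2; [exact: nearw|exact: nearw|move=> c_uv].
  by rewrite !ord.
exact: (tp2_order (goodk k).1 (goodk k).2 euM evM fuM fvM (esym cuv) (blk u erefl)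
  (blk v (esym cuv)) ns euv fuv tp).
Qed.

End Refinement.

Lemma one_point : exists (c : T -> 'I_one_point_bound) (r : T -> nat),
  separating c r /\ compatible rho c r rho c r.
Proof.
(* With at most [s0] points, each gets its own colour. Otherwise there is room for the [m] points
   [a k] and for a point [star] outside [S0]. *)
have [small|large] := leqP #|T| s0.
  have le : #|T| <= one_point_bound.
    apply: leq_trans small _; rewrite /one_point_bound card_sum card_ord; lia.
  pose c x : 'I_one_point_bound := widen_ord le (enum_rank x).
  have cinj : injective c.
    by move=> x y /(congr1 val) /= xy; apply: enum_rank_inj; apply: val_inj.
  exists c, (fun=> 0); split=> [x y /cinj //|i t t' tc _].
  have -> // : t = t' by apply: eq_from_tnth => a; apply: cinj.
have mT : m <= #|T| by apply: leq_trans (ltnW large); rewrite /s0; lia.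
pose a (k : 'I_m) : T := enum_val (widen_ord mT k).
have a_inj : injective a.
  by move=> k l /enum_val_inj /(congr1 val) /= kl; apply: val_inj.
have [ck ckP] := choice (fun k => deletions (a k)).
have [rk goodk] := choice ckP.
have := card_S0 goodk.
set S0 := (X in #|X|) => cS0.
have [star starN] : exists x, x \notin S0.
  apply/existsP; rewrite -negb_forall; apply: contraL large => /forallP all.
  rewrite -leqNgt; apply: leq_trans cS0; apply: subset_leq_card.
  by apply/fintype.subsetP => x _; apply: all.
have [c [r goods]] := deletions star.
have sep := refined_separating goodk starN goods.
have comp := refined_compatible a_inj goodk starN goods.
set col := refined_colour _ _ _ _ _ _ in sep comp.
exists (fun x => enum_rank (col x)), r; split.
  by move=> x y /enum_rank_inj; apply: sep.
move=> i t t' tc tr; apply: comp => [b|b b' cb].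
  by apply: enum_rank_inj; apply: tc.
by apply: tr; rewrite cb.
Qed.

End OnePoint.

Section OnePointStructure.
Variables (I : finType) (mu : I -> nat).
Local Notation structure := (structure mu).
Implicit Types R S : structure.

Definition arity : nat := \max_i mu i.

Lemma arity_max i : mu i <= arity.
Proof. exact: leq_bigmax. Qed.

(** [R] is renumbered by ['I_n]. At the deleted point the colour [ord0] is a default, whence the
    positive number [N.+1] of colours. *)
Lemma cx_one_point (N : nat) R : finite_structure R ->
  (forall x : dom R, cx N.+1 (restrict [set y | y <> x]%classic)) ->
  cx (one_point_bound arity N.+1) R.
Proof.
move=> /finite_enumP[n [e [g eK gK]]] Rx.
pose rho i (t : (mu i).-tuple 'I_n) := rel_of R i (map_tuple e t).
have [|c [r [sep comp]]] := @one_point I mu 'I_n rho arity N.+1 arity_max.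
  move=> a; have [c0 [r0 [sep0 comp0]]] := Rx (e a).
  pose lift x : option {y : dom R | [set y | y <> e a]%classic y} :=
    if pselect ([set y | y <> e a]%classic (e x)) is left p
    then Some (exist _ (e x) p) else None.
  have liftP x : x \in ~: [set a] -> exists2 y, lift x = Some y & sval y = e x.
    rewrite !inE /lift => xa; case: pselect => [p|]; first by exists (exist _ (e x) p).
    by case => /= /(can_inj eK) exa; rewrite exa eqxx in xa.
  exists (fun x => oapp c0 ord0 (lift x)), (fun x => oapp r0 0 (lift x)).
  split=> [x y /liftP[x' -> ex] /liftP[y' -> ey] /= cxy rxy|i t t' tA t'A tc tr].
    by apply: (can_inj eK); rewrite -ex -ey (sep0 _ _ cxy rxy).
  have pre (s : (mu i).-tuple 'I_n) : (forall b, tnth s b \in ~: [set a]) ->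
      exists s' : (mu i).-tuple {y : dom R | [set y | y <> e a]%classic y},
        forall b, lift (tnth s b) = Some (tnth s' b) /\
                  sval (tnth s' b) = e (tnth s b).
    move=> sA; have /choice[h hP] : forall b, exists y, lift (tnth s b) = Some y /\
        sval y = e (tnth s b).
      by move=> b; have [y ly ye] := liftP _ (sA b); exists y.
    by exists [tuple h b | b < mu i] => b; rewrite tnth_mktuple.
  have [s sP] := pre t tA; have [s' s'P] := pre t' t'A.
  have relE (u : (mu i).-tuple 'I_n) v :
      (forall b, lift (tnth u b) = Some (tnth v b) /\
                  sval (tnth v b) = e (tnth u b)) ->
      rho i u <-> rel_of (restrict [set y | y <> e a]%classic) i v.
    move=> uv; rewrite /rho /=.
    have -> : map_tuple e u = map_tuple (@sval _ _) v.
      by apply: eq_from_tnth => b; rewrite !tnth_map (uv b).2.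
    by [].
  rewrite (relE t s sP) (relE t' s' s'P); apply: comp0 => [b|b b' cb].
    by have := tc b; rewrite (sP b).1 (s'P b).1.
  have := tr b b'; rewrite (sP b).1 (s'P b).1 (sP b').1 (s'P b').1 /=.
  exact.
exists (c \o g), (r \o g); split=> [x y cxy rxy|i t t' tc tr].
  by apply: (can_inj gK); apply: sep.
have := comp i (map_tuple g t) (map_tuple g t').
rewrite /rho !(map_tuple_cancel _ gK); apply=> [b|b b'].
  by rewrite !tnth_map; apply: tc.
by rewrite !tnth_map; apply: tr.
Qed.

End OnePointStructure.

(** * Ramsey's theorem and monomorphic decompositions *)

Lemma infinite_pigeonhole (U : finType) (u : nat -> U) :
  exists2 phi : nat -> nat, {homo phi : a b / a < b} &
    exists x, forall n, u (phi n) = x.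
Proof.
have [x xP] : exists x, forall n, exists k, n <= k /\ u k = x.
  apply/not_existsP => none.
  have pre x : exists n, forall k, n <= k -> u k <> x.
    have /existsNP[n nP] := none x; exists n => k nk ux.
    by apply: nP; exists k.
  have [g gP] := choice pre.
  apply: (gP (u (\max_x g x)) (\max_x g x)) => //.
  exact: leq_bigmax.
have [g gP] := choice xP.
pose fix phi n := if n is n'.+1 then g (phi n').+1 else g 0.
exists phi; last first.
  by exists x => -[|n]; [have [] := gP 0|have [] := gP (phi n).+1].
by apply: (homo_ltn ltn_trans) => n; have [] := gP (phi n).+1.
Qed.

Lemma sorted_map_homo (phi : nat -> nat) (s : seq nat) :
  {homo phi : a b / a < b} -> sorted ltn s -> sorted ltn (map phi s).
Proof. by move=> phiS; apply: homo_sorted. Qed.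

(** Nested subsequences: [psi n.+1] is taken from [psi n] without its first term, so that this first
    term followed by [m] terms of [psi n.+1] always has the same colour. Along the first terms the
    colour depends only on the least element; the pigeonhole principle makes it constant. *)
Lemma ramsey (U : finType) (m : nat) (f : seq nat -> U) :
  exists2 phi : nat -> nat, {homo phi : a b / a < b} &
    exists x, forall s, sorted ltn s -> size s = m -> f (map phi s) = x.
Proof.
elim: m f => [|m IHm] f.
  by exists id => //; exists (f [::]) => -[].
have step (psi : nat -> nat) : exists w : (nat -> nat) * U,
    {homo w.1 : a b / a < b} /\ forall s, sorted ltn s -> size s = m ->
      f (psi 0 :: map (psi \o S \o w.1) s) = w.2.
  have [phi phiS [x xP]] := IHm (fun s => f (psi 0 :: map (psi \o S) s)).
  by exists (phi, x); split=> // s ss sm; rewrite -(xP s ss sm) -map_comp.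
have [g gP] := choice step.
pose fix psi n : nat -> nat := if n is n'.+1 then psi n' \o S \o (g (psi n')).1 else id.
have psiS n : {homo psi n : a b / a < b}.
  elim: n => // n IHn a b ab; apply: IHn; rewrite ltnS.
  by apply: (gP _).1.
have range n k : n <= k -> exists h : nat -> nat,
    {homo h : a b / a < b} /\ psi k =1 psi n \o h.
  move=> /subnKC <-; elim: (k - n) => [|d [h [hS hE]]].
    by rewrite addn0; exists id; split=> [a b ab|a]; [exact: ab|].
  rewrite addnS; exists (h \o S \o (g (psi (n + d))).1); split.
    by move=> a b ab; apply: hS; rewrite ltnS; apply: (gP _).1.
  by move=> a; rewrite /= hE.
pose alpha n := psi n 0.
have alphaS : {homo alpha : a b / a < b}.
  apply: (homo_ltn ltn_trans) => n; rewrite /alpha /=.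
  by apply: psiS.
have [phi phiS [x xP]] := infinite_pigeonhole (fun n => (g (psi n)).2).
exists (alpha \o phi); first by move=> a b ab; apply: alphaS; apply: phiS.
exists x => -[//|a s] /= ss [sm]; rewrite -(xP a).
have [_ aP] := gP (psi (phi a)).
have lift k : a < k -> exists l, alpha (phi k) = psi (phi a).+1 l.
  move=> ak; have [h [_ hE]] := range (phi a).+1 (phi k) (phiS _ _ ak).
  by exists (h 0); rewrite /alpha hE.
have [t tE] : exists t, map (alpha \o phi) s = map (psi (phi a).+1) t.
  have /allP : all (fun k => a < k) s := order_path_min ltn_trans ss.
  elim: s {ss sm} => [|k s IHs] all; first by exists [::].
  have [t tE] := IHs (fun l ls => all l (mem_behead (s := k :: s) ls)).
  have [l lE] := lift k (all k (mem_head _ _)).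
  by exists (l :: t); congr cons; [exact: lE|exact: tE].
rewrite [map _ s]tE -(aP t) //; last first.
  by rewrite -sm -(size_map (alpha \o phi) s) tE size_map.
have ps : sorted ltn (map (alpha \o phi) s).
  apply: sorted_map_homo (path_sorted ss).
  by move=> b b' bb'; apply: alphaS; apply: phiS.
move: ps; rewrite tE sorted_map; apply: sub_sorted => b b'.
case: (ltnP b b') => // b'b lt; have : psi (phi a).+1 b' <= psi (phi a).+1 b.
  by case: (ltngtP b' b) b'b => [/psiS/ltnW|//|->].
by rewrite leqNgt => /negP; case.
Qed.

(** The indices [l] list the distinct values of both families in increasing order; both lists are
    then padded to length [m] by numbers above all the values. *)
Lemma common_positions (k m : nat) (u u' : 'I_k -> nat) : k <= m ->
  (forall a b, (u a <= u b) = (u' a <= u' b)) ->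
  exists (s s' : seq nat) (w : 'I_k -> 'I_m),
    [/\ sorted ltn s /\ sorted ltn s', size s = m /\ size s' = m &
        forall a, nth 0 s (w a) = u a /\ nth 0 s' (w a) = u' a].
Proof.
move=> km uu'; pose s0 := sort leq (undup (codom u)).
have s0u a : u a \in s0 by rewrite mem_sort mem_undup codom_f.
have [l lE] : exists l, map u l = s0.
  have : {subset s0 <= codom u} by move=> x; rewrite mem_sort mem_undup.
  elim: s0 {s0u} => [|x s IHs] sub; first by exists [::].
  have [l lE] := IHs (fun y ys => sub y (mem_behead (s := x :: s) ys)).
  have /codomP[b xb] := sub x (mem_head _ _).
  by exists (b :: l); rewrite /= lE -xb.
have s0S : sorted ltn s0.
  by rewrite ltn_sorted_uniq_leq sort_uniq undup_uniq sort_sorted //; apply: leq_total.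
have s0m : size s0 <= m.
  rewrite size_sort; apply: leq_trans (size_undup _) _.
  by rewrite size_codom card_ord.
have uu'lt a b : (u a < u b) = (u' a < u' b) by rewrite !ltnNge uu'.
have s0'S : sorted ltn (map u' l).
  by move: s0S; rewrite -lE !sorted_map; apply: sub_sorted => a b /=; rewrite uu'lt.
pose pad (v : 'I_k -> nat) := iota (\max_a v a).+1 (m - size s0).
have padS (v : 'I_k -> nat) : sorted ltn (map v l) -> sorted ltn (map v l ++ pad v).
  rewrite !(sorted_pairwise ltn_trans) pairwise_cat => -> /=.
  rewrite -(sorted_pairwise ltn_trans) iota_ltn_sorted andbT.
  apply/allrelP => x y /mapP[b _ ->]; rewrite mem_iota => /andP[+ _].
  by apply: leq_trans; rewrite ltnS; apply: leq_bigmax.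
have szl : size l = size s0 by rewrite -lE size_map.
have pos a : index (u a) s0 < size s0 by rewrite index_mem.
exists (map u l ++ pad u), (map u' l ++ pad u'),
  (fun a => Ordinal (leq_trans (pos a) s0m)); split.
- by split; apply: padS; rewrite ?lE.
- by rewrite !size_cat !size_map !size_iota szl subnKC.
move=> a; rewrite /= !nth_cat !size_map szl pos lE nth_index //; split=> //.
rewrite (nth_map a) ?szl ?pos //; set b := nth a l _.
have ub : u b = u a by rewrite -(nth_map a 0) ?szl ?pos // lE nth_index.
by apply/eqP; rewrite eqn_leq -!uu' ub leqnn.
Qed.

Section Decompositions.
Variables (I : finType) (mu : I -> nat).
Local Notation structure := (structure mu).
Implicit Types R S : structure.
Local Open Scope classical_set_scope.

(* Ramsey's theorem yields jointly indiscernible sequences in the infinite blocks; a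
   finite set is isomorphic to one taken from these sequences, where points of
   distinct blocks have indices in disjoint intervals. *)
Lemma fmd_cx R (m : nat) : (forall i, mu i <= m) ->
  has_finite_monomorphic_decomposition R ->
  exists N, forall S, age R S -> cx N S.
Proof.
move=> mum [J [B [[Bcover Btriv Bne] Bmono]]].
(* An infinite block gets an injective sequence, a finite one a constant sequence as a filler. *)
have xex j : exists xj : nat -> dom R,
    (forall n, B j (xj n)) /\ (infinite_set (B j) -> injective xj).
  have [y By] := Bne j Logic.I; have [Bfin|Binf] := pselect (finite_set (B j)).
    by exists (fun=> y).
  have /infiniteP/card_leP/injfunPex[f _ finj] := Binf.
  exists (fun n => val (f (exist _ n (mem_setT n)))); split=> [n|_ a b fab].
    by apply/set_mem/valP.
  have /finj : f (exist _ a (mem_setT a)) = f (exist _ b (mem_setT b)).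
    exact: val_inj.
  by rewrite !in_setT => /(_ isT isT) [].
have [x xP] := choice xex.
have [f [fe feP]] : exists f (fe : 'I_f -> dom R), forall j y, finite_set (B j) ->
    B j y -> exists k, fe k = y.
  have [f [fe [_ feE]]] : exists n (e : 'I_n -> dom R), injective e /\
      \bigcup_(j in [set j | finite_set (B j)]) B j = range e.
    by apply: finite_set_enum; apply: bigcup_finite.
  exists f, fe => j y jfin By; have : (\bigcup_(j in [set j | finite_set (B j)]) B j) y.
    by exists j.
  by rewrite feE => -[k _ <-]; exists k.
(* Tuples become words in finitely many letters: points of finite blocks, and pairs of a position
   and a block. *)
pose Y : finType := ('I_f + 'I_m * J)%type.
pose g (s : seq nat) (y : Y) : dom R :=
  match y with inl k => fe k | inr (a, j) => x j (nth 0 s a) end.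
pose chi s : {set {i : I & (mu i).-tuple Y}} :=
  [set v | `[< rel_of R (tag v) (map_tuple (g s) (tagged v)) >]]%SET.
have [phi phiS [X XE]] := ramsey m chi.
have gE s s' i (v : (mu i).-tuple Y) : sorted ltn s -> sorted ltn s' ->
    size s = m -> size s' = m ->
    rel_of R i (map_tuple (g (map phi s)) v) <->
    rel_of R i (map_tuple (g (map phi s')) v).
  move=> sS s'S sm s'm.
  have : chi (map phi s) = chi (map phi s') by rewrite !XE.
  move=> /finset.setP/(_ (Tagged (fun i => (mu i).-tuple Y) v)); rewrite !inE /= => e.
  by split=> rv; apply/asboolP; [rewrite -e|rewrite e]; apply/asboolP.
have phi_inj : injective phi.
  move=> a b; case: (ltngtP a b) => // /phiS + ab; by rewrite ab ltnn.
exists #|(('I_f + J)%type : finType)| => S /ageP[/finite_enumP[n [e ebij]] /embedsP[h0 h0E]].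
pose h := h0 \o e; have hinj : injective h := inj_comp h0E.1 (bij_inj ebij).
have jex k : exists j, B j (h k).
  by have : [set: dom R] (h k) by []; rewrite -Bcover => -[j _ Bj]; exists j.
have [jof jofP] := choice jex.
pose isf k := `[< finite_set (B (jof k)) >].
(* Numbers attached to distinct blocks lie in disjoint intervals of length [n]; the successor keeps
   [0] for the points of finite blocks. *)
pose q k := (n * enum_rank (jof k) + k).+1.
pose h' k := if isf k then h k else x (jof k) (phi (q k)).
have h'B k : B (jof k) (h' k) by rewrite /h'; case: ifP => _ //; case: (xP (jof k)).
have jofE k l : h' k = h' l -> jof k = jof l.
  move=> kl; apply: (Btriv) => //; exists (h' k); split; first exact: h'B.
  by rewrite kl.
have h'inj : injective h'.
  move=> k l kl; have jkl := jofE k l kl; move: kl; rewrite /h' /isf jkl.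
  case: asboolP => Bf; first exact: hinj.
  move/((xP (jof l)).2 Bf)/phi_inj => []; rewrite jkl => /addnI kl.
  exact: val_inj.
have iso : isomorphic (restrict (range h)) (restrict (range h')).
  apply: Bmono => [||j].
  - exact: finite_image.
  - exact: finite_image.
  have part (d : 'I_n -> dom R) : injective d -> (forall k, B (jof k) (d k)) ->
      (range d `&` B j #= [set k | jof k = j])%card.
    move=> dinj dB.
    have -> : range d `&` B j = d @` [set k | jof k = j].
      apply/seteqP; split=> [_ [[k _ <-] Bk]|_ [k jk <-]].
        exists k => //=; apply: Btriv => //; by exists (d k).
      by split; [exists k|rewrite -jk].
    by apply: inj_card_eq => k l _ _; apply: dinj.
  by apply: card_eq_trans (part h hinj jofP) _; rewrite card_eq_sym part.
have Spull : embeds S (pull h').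
  apply: iso_embeds; apply: iso_trans (iso_sym (pull_restrict_iso h'inj erefl)).
  apply: iso_trans iso; apply: restrict_range_iso h0E _.
  have [d eK dK] := ebij; apply/seteqP; split=> _ [k _ <-].
    by exists (e k).
  by exists (d k); rewrite // /h /= dK.
apply: cx_embeds Spull _.
(* Points of finite blocks get their own colours; all points of an infinite block share one. *)
have colex k : exists c : 'I_f + J, match c with
    | inl a => isf k /\ fe a = h' k | inr j => ~~ isf k /\ j = jof k end.
  case: (boolP (isf k)) => fk; last by exists (inr (jof k)).
  by have [a aE] := feP _ _ (asboolW fk) (h'B k); exists (inl a).
have [col colP] := choice colex.
pose u k := if isf k then 0 else q k.
have uE k l : col k = col l -> (isf k = isf l) /\ (~~ isf k -> jof k = jof l).
  have := colP k; have := colP l; case: (col l) => [a|j]; case: (col k) => [b|j'] //.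
    by move=> [-> _] [-> _] _.
  by move=> [/negbTE -> ->] [/negbTE -> ->] [->].
have ult k l : isf k = false -> isf l = false -> jof k != jof l ->
    (q k <= q l) = (enum_rank (jof k) < enum_rank (jof l)).
  move=> _ _ kl; have := ltn_ord k; have := ltn_ord l.
  have : val (enum_rank (jof k)) <> val (enum_rank (jof l)).
    by move/val_inj/enum_rank_inj/eqP; rewrite (negbTE kl).
  rewrite /q /=; move: (nat_of_ord (enum_rank _)) (nat_of_ord (enum_rank _)) => x1 x2.
  nia.
apply: (@good_cx _ _ (('I_f + J)%type : finType) (pull h') (col \o ord_of) (q \o ord_of)) => //.
split=> [k l /= ckl qkl|i t t' tc tr].
  apply: (can_inj (@ord_ofK n)); apply: h'inj.
  have := colP (ord_of k); have := colP (ord_of l); rewrite ckl.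
  case: (col _) => [b|j]; first by move=> [_ <-] [_ <-].
  move=> [_ ->] [_ jkl]; congr h'; apply: val_inj.
  by move: qkl; rewrite /q jkl => -[] /addnI.
pose k_ b := ord_of (tnth t b); pose k'_ b := ord_of (tnth t' b).
have [|s [s' [w [[sS s'S] [sm s'm] sE]]]] :=
    @common_positions (mu i) m (u \o k_) (u \o k'_) (mum i).
  move=> b b'; rewrite /u /=.
  have [f1 j1] := uE _ _ (tc b); have [f2 j2] := uE _ _ (tc b').
  rewrite -/(k_ b) -/(k_ b') -/(k'_ b) -/(k'_ b') in f1 f2 j1 j2.
  rewrite -f1 -f2; case: ifPn => n1; case: ifPn => n2 //.
  have [jE|jN] := eqVneq (jof (k_ b)) (jof (k_ b')).
    apply: tr; rewrite /=; have := colP (k_ b); have := colP (k_ b').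
    rewrite -/(k_ b) -/(k_ b'); case: (col (k_ b)) => [a|j]; case: (col (k_ b')) => [a'|j'].
    - by move=> [+ _]; rewrite (negbTE n2).
    - by move=> _ [+ _]; rewrite (negbTE n1).
    - by move=> [+ _]; rewrite (negbTE n2).
    - by move=> [_ ->] [_ ->]; rewrite jE.
  have {}j1 := j1 n1; have {}j2 := j2 n2.
  have F1 := negbTE n1; have F2 := negbTE n2.
  by rewrite ult // ult -?j1 -?j2 // -?f1 -?f2.
(* Both tuples are the same word [v], read along [s] for [t] and along [s'] for [t'];
   indiscernibility compares the two readings. *)
pose v : (mu i).-tuple Y := [tuple (if col (k_ b) is inl a then inl a
  else inr (w b, jof (k_ b))) | b < mu i].
have vE (z : seq nat) (d : 'I_(mu i) -> 'I_n) : sorted ltn z -> size z = m ->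
    (forall b, nth 0 z (w b) = u (d b)) -> (forall b, col (k_ b) = col (d b)) ->
    map_tuple (g (map phi z)) v = [tuple h' (d b) | b < mu i].
  move=> zS zm zE cd; apply: eq_from_tnth => b; rewrite tnth_map !tnth_mktuple.
  have := colP (d b); have [_ jd] := uE _ _ (cd b); rewrite cd.
  have := colP (k_ b); rewrite cd.
  case: (col (d b)) => [a|j] /=; first by move=> _ [].
  move=> [nk _] [nd _]; rewrite (nth_map 0) ?zm // zE /u (negbTE nd) /h' (negbTE nd).
  by rewrite jd.
have h1 := vE s k_ sS sm (fun b => (sE b).1) (fun=> erefl).
have h2 := vE s' k'_ s'S s'm (fun b => (sE b).2) tc.
have -> : rel_of (pull h') i t <-> rel_of R i (map_tuple (g (map phi s)) v).
  rewrite h1 /=; have -> : map_tuple (h' \o ord_of) t = [tuple h' (k_ b) | b < mu i] => //.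
  by apply: eq_from_tnth => b; rewrite tnth_map tnth_mktuple.
have -> : rel_of (pull h') i t' <-> rel_of R i (map_tuple (g (map phi s')) v).
  rewrite h2 /=; have -> : map_tuple (h' \o ord_of) t' = [tuple h' (k'_ b) | b < mu i] => //.
  by apply: eq_from_tnth => b; rewrite tnth_map tnth_mktuple.
exact: gE.
Qed.

End Decompositions.

Lemma card_eq_set (V W : finType) (D : {set V}) (E : {set W}) :
  ([set` D] #= [set` E])%card%classic -> #|D| = #|E|.
Proof.
have enumD (U : finType) (F : {set U}) : ([set` F] #= `I_#|F|)%card%classic.
  apply/card_set_bijP; exists (fun x => index x (enum F)); split.
  - by move=> x /= xF; rewrite cardE index_mem mem_enum.
  - move=> x y /set_mem /= xF /set_mem /= yF xy.
    by rewrite -(nth_index x (s := enum F) (x := x)) ?mem_enum // xy nth_index ?mem_enum.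
  - move=> k /= kF; have kE : k < size (enum F) by rewrite -cardE.
    have x0 : U by case: (enum F) kE => [|x].
    exists (nth x0 (enum F) k); first by rewrite /= -mem_enum mem_nth.
    by rewrite index_uniq // enum_uniq.
move=> DE; apply/card_eq_II; apply: card_eq_trans (enumD _ E).
by apply: card_eq_trans DE; rewrite card_eq_sym.
Qed.

(** * From bounded complexity to finite monomorphic decompositions *)

Section Swap.
Variables (I : finType) (mu : I -> nat).
Local Notation structure := (structure mu).
Implicit Types R S : structure.

(* [x] and [y] may replace each other in every finite set, up to isomorphism. The
   classes of this relation are the blocks of a monomorphic decomposition. *)
Definition swappable R (x y : dom R) : Prop :=
  x = y \/ forall n (e : 'I_n -> dom R) v, injective e -> e v = x ->
    (forall w, e w <> y) -> isomorphic (pull e) (pull (upd e v y)).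

Lemma pull_tperm R n (e : 'I_n -> dom R) v w :
  isomorphic (pull e) (pull (e \o tperm v w)).
Proof.
apply: (@pull_iso_pull _ _ _ _ _ _ _ (tperm v w)); first exact: perm_inj.
move=> i t; have -> // : map_tuple e t = map_tuple ((e \o tperm v w) \o tperm v w) t.
by apply: eq_map_tuple => a; rewrite /= tpermK.
Qed.

Lemma swappable_sym R (x y : dom R) : swappable x y -> swappable y x.
Proof.
move=> [->|xy]; first by left.
have [->|neq] := pselect (x = y); first by left.
right=> n e v einj ev ex.
have inj' : injective (upd e v x) by apply: upd_inj => // w _.
have := xy n (upd e v x) v inj' (upd_same _ _ _).
rewrite upd_upd -ev upd_id => iso; apply: iso_sym; apply: iso => w.
have [->|wv] := eqVneq w v; first by rewrite upd_same ev.
by rewrite upd_other // => /einj wv'; rewrite wv' eqxx in wv.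
Qed.

Lemma swappable_trans R (x y z : dom R) :
  swappable x y -> swappable y z -> swappable x z.
Proof.
move=> [->//|xy] [<-|yz]; first by right.
have [xz|xz] := pselect (x = z); first by left.
right=> n e v einj ev ez.
have [yz'|nyz] := pselect (y = z); first by rewrite -yz' in ez *; apply: xy.
have [nxy|nxy] := pselect (x = y); first by apply: yz => //; rewrite ev.
(* If [y] already occurs in the family, it is moved to [z] first, then [x] to [y]: the outcome
   differs from the wanted family by a transposition of indices. *)
have [[w ew]|ey] := pselect (exists w, e w = y); last first.
  have {}ey w : e w <> y by move=> ew; apply: ey; exists w.
  apply: iso_trans (xy n e v einj ev ey) _; rewrite -(upd_upd e v y z).
  apply: yz; rewrite ?upd_same //; first by apply: upd_inj => // w _.
  by move=> w; rewrite /upd; case: (w == v).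
have vw : v != w by apply/eqP => vw; apply: nxy; rewrite -ev -ew vw.
have wv : w != v by rewrite eq_sym.
apply: iso_trans (yz n e w einj ew ez) _.
have inj1 : injective (upd e w z) by apply: upd_inj => // u _.
apply: iso_trans (xy n (upd e w z) v inj1 _ _) _; first by rewrite upd_other.
  move=> u; have [->|uw] := eqVneq u w; first by rewrite upd_same => /esym.
  by rewrite upd_other // -ew => /einj uw'; rewrite uw' eqxx in uw.
apply: iso_trans (pull_tperm _ v w) _.
suff -> : upd (upd e w z) v y \o tperm v w = upd e v z by apply: iso_refl.
apply: funext => u /=; case: tpermP => [->|->|/eqP uv /eqP uw].
- by rewrite upd_other // !upd_same.
- by rewrite upd_same upd_other.
- by rewrite !upd_other.
Qed.

(** Disagreements are removed one at a time; when the target [f v] is already a value of [e], a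
    transposition of indices brings it to [v]. *)
Lemma swappable_iso R n (e f : 'I_n -> dom R) :
  injective e -> injective f -> (forall k, swappable (e k) (f k)) ->
  isomorphic (pull e) (pull f).
Proof.
move=> + finj; pose D (e : 'I_n -> dom R) := [set k | `[< e k <> f k >]].
have [d] := ubnP #|D e|; elim: d e => // d IHd e; rewrite ltnS => De einj ef.
have shrink (g : 'I_n -> dom R) v : e v <> f v -> g v = f v ->
    (forall w, w != v -> g w <> f w -> e w <> f w) -> #|D g| < d.
  move=> ev gv gw; apply: leq_trans De; apply: proper_card; apply/properP; split.
    apply/fintype.subsetP => w; rewrite !finset.in_set => /asboolP gfw; apply/asboolP.
    by apply: gw => //; apply/eqP => wv; apply: gfw; rewrite wv.
  by exists v; rewrite !finset.in_set; [apply/asboolP|apply/negP => /asboolP].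
have [all|/existsNP[v ev]] := pselect (forall v, e v = f v).
  by rewrite (funext all); apply: iso_refl.
have [[w ew]|fresh] := pselect (exists w, e w = f v); last first.
  have {}fresh w : e w <> f v by move=> ew; apply: fresh; exists w.
  have [//|sw] := ef v.
  apply: iso_trans (sw n e v einj erefl fresh) _; apply: IHd.
  - by apply: (shrink _ v) => //; [rewrite upd_same|move=> w wv; rewrite upd_other].
  - by apply: upd_inj => // w _.
  - by move=> k; rewrite /upd; case: eqP => [->|_]; [left|apply: ef].
have vw : v != w by apply/eqP => vw; apply: ev; rewrite -ew vw.
apply: iso_trans (pull_tperm e v w) _; apply: IHd.
- apply: (shrink _ v) => //; first by rewrite /= tpermL.
  move=> u uv /=; case: tpermP => [uE|uE|//]; first by rewrite uE eqxx in uv.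
  by move=> _; rewrite uE ew => /finj vw'; rewrite vw' eqxx in vw.
- exact: inj_comp einj (@perm_inj _ _).
- move=> k /=; case: tpermP => [->|->|_ _]; last exact: ef.
    by left.
  by apply: swappable_trans (ef v) _; rewrite -ew; apply: ef.
Qed.


Lemma restrict_age R (A : set (dom R)) : finite_set A -> age R (restrict A).
Proof. by move=> Afin; exists A; split=> //; apply: iso_refl. Qed.

(** A finite set [Z] contains witnesses of non-swappability for all pairs. With [N] colours on [Z],
    two of the [N.+1] points share a colour; replacing one by the other keeps the sizes of the
    colour classes, so [compatible_map] gives the isomorphism that the witness excludes. *)
Lemma cx_swappable (N : nat) R (x : 'I_N.+1 -> dom R) :
  (forall S, age R S -> cx N S) -> exists i j, i != j /\ swappable (x i) (x j).
Proof.
move=> Rcx; apply: contrapT => none.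
have wit (ij : 'I_N.+1 * 'I_N.+1) : exists A : set (dom R), finite_set A /\
    (ij.1 != ij.2 -> exists n (e : 'I_n -> dom R) v, [/\ injective e,
      e v = x ij.1, forall w, e w <> x ij.2, range e `<=` A &
      ~ isomorphic (pull e) (pull (upd e v (x ij.2)))])%classic.
  case: ij => i j /=; have [->|ij] := eqVneq i j; first by exists classical_sets.set0.
  have /not_orP[_ /existsNP[n /existsNP[e /existsNP[v /not_implyP[einj]]]]] :
    ~ swappable (x i) (x j) by move=> sw; apply: none; exists i, j.
  move=> /not_implyP[ev /not_implyP[ex niso]].
  exists (range e); split; first exact: finite_image.
  by move=> _; exists n, e, v; split=> // y.
have [A AP] := choice wit.
pose Z : set (dom R) := (range x `|` \bigcup_(ij in [set: 'I_N.+1 * 'I_N.+1]) A ij)%classic.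
have Zx i : Z (x i) by left; exists i.
have ZA ij y : A ij y -> Z y by right; exists ij.
have Zfin : finite_set Z.
  rewrite finite_setU; split; first exact: finite_image.
  by apply: bigcup_finite => // ij _; case: (AP ij).
have [c [r [sep comp]]] := Rcx _ (restrict_age Zfin).
pose xZ i : dom (restrict Z) := exist _ (x i) (Zx i).
have /injectivePn[i [j ij cij]] : ~~ injectiveb (c \o xZ).
  by apply/injectiveP => /leq_card; rewrite !card_ord ltnn.
have [_ /(_ ij)[n [e [v [einj ev ex eA niso]]]]] := AP (i, j).
rewrite /= in ev ex niso; apply: niso.
have eZ k : Z (e k) by apply: (ZA (i, j)); apply: eA; exists k.
pose eL k : dom (restrict Z) := exist _ (e k) (eZ k).
pose fL := upd eL v (xZ j).
have svinj := (@embedding_val _ _ R Z).1.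
have eLinj : injective eL by move=> k l /(congr1 (@sval _ _)) /einj.
have fLE k : sval (fL k) = upd e v (x j) k by rewrite /fL /upd; case: (k == v).
have fLinj : injective fL.
  by apply: upd_inj => // w _ /(congr1 (@sval _ _)); apply: ex.
have cE k : c (fL k) = c (eL k).
  rewrite /fL /upd; case: (eqVneq k v) => // ->; rewrite -[LHS]cij /=; congr c.
  by apply: svinj; rewrite /= ev.
have [|g ginj gP] := compatible_map eLinj fLinj sep sep comp.
  by move=> k; apply: subset_leq_card; apply/fintype.subsetP => w; rewrite !inE cE.
apply: (pull_iso_pull ginj) => l t; have := gP l t; rewrite /= !map_tupleK.
have -> : map_tuple (@sval _ _ \o eL) t = map_tuple e t by apply: eq_map_tuple.
have -> // : map_tuple (@sval _ _ \o (fL \o g)) t = map_tuple (upd e v (x j) \o g) t.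
by apply: eq_map_tuple => a; rewrite /= fLE.
Qed.

(** By [cx_swappable], at most [N] points are pairwise non-swappable; a largest such system
    represents all the classes, which are the blocks. *)
Lemma cx_fmd (N : nat) R : (forall S, age R S -> cx N S) ->
  has_finite_monomorphic_decomposition R.
Proof.
move=> Rcx.
pose free p := `[< exists x : 'I_p -> dom R, forall i j, swappable (x i) (x j) -> i = j >].
have free0 : exists p, free p.
  by exists 0; apply/asboolP; exists (fun i : 'I_0 => False_rect _ (notF (ltn_ord i))) => -[].
have freeN p : free p -> p <= N.
  move=> /asboolP[x xP]; rewrite leqNgt; apply/negP => Np.
  have [i [j [ij /xP /(congr1 val) /= ijE]]] := cx_swappable (fun i => x (widen_ord Np i)) Rcx.
  by move: ij; rewrite (val_inj ijE) eqxx.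
case: (ex_maxnP free0 freeN) => p /asboolP[x xP] pmax.
have cover y : exists i, swappable (x i) y.
  apply: contrapT => none; have /pmax : free p.+1; last by rewrite ltnn.
  apply/asboolP; exists (fun i => if unlift ord_max i is Some j then x j else y).
  move=> i j; case: unliftP => [i' ->|->]; case: unliftP => [j' ->|->] //.
  - by move/xP => ->.
  - by move=> sw; case: none; exists i'.
  - by move=> /swappable_sym sw; case: none; exists j'.
exists 'I_p, (fun i => [set y | swappable (x i) y]%classic); split.
  split.
  - by apply/seteqP; split=> // y _; have [i iy] := cover y; exists i.
  - move=> i j _ _ [y [iy jy]]; apply: xP; apply: swappable_trans iy _.
    exact: swappable_sym.
  - by move=> i _; exists (x i); left.
move=> A A' /finite_set_enum[n [e [einj ->]]] /finite_set_enum[n' [e' [e'inj ->]]] cnt.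
have [c cP] := choice (fun k => cover (e k)).
have [c' c'P] := choice (fun k => cover (e' k)).
have cntE k : #|[set v | c v == k]| = #|[set v | c' v == k]|.
  apply: card_eq_set.
  have part q (d : 'I_q -> dom R) (b : 'I_q -> 'I_p) : injective d ->
      (forall l, swappable (x (b l)) (d l)) ->
      ((range d `&` [set y | swappable (x k) y]) #= [set` [set v | b v == k]%SET])%card%classic.
    move=> dinj db; have -> : (range d `&` [set y | swappable (x k) y] =
        d @` [set` [set v | b v == k]%SET])%classic.
      apply/seteqP; split=> [_ [[l _ <-] kl]|_ [l + <-]] /=.
        exists l => //=; rewrite inE; apply/eqP; apply: xP.
        by apply: swappable_trans (db l) _; apply: swappable_sym.
      by rewrite /mkset finset.in_set => /eqP <-; split=> //; exists l.
    by apply: inj_card_eq => l l' _ _; apply: dinj.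
  by apply: card_eq_trans (part _ _ _ e'inj c'P); rewrite card_eq_sym;
    apply: card_eq_trans (part _ _ _ einj cP); rewrite card_eq_sym.
have sepv q (b : 'I_q -> 'I_p) : forall u v, b u = b v -> val u = val v -> u = v.
  by move=> u v _; apply: val_inj.
(* Equal class sizes give a class-preserving injection of indices; an injection in the other
   direction shows that it is onto. *)
have [|f [finj fc _]] := colour_embedding (sepv _ c) (sepv _ c').
  by move=> k; rewrite cntE.
have [|f' [f'inj _ _]] := colour_embedding (sepv _ c') (sepv _ c).
  by move=> k; rewrite cntE.
have fsurj w : exists v, f v = w.
  have := inj_card_onto finj; rewrite !card_ord => onto.
  have /codomP[v ->] : w \in codom f; last by exists v.
  by apply: inj_card_onto; rewrite // (leq_card _ f'inj).
apply: iso_trans (iso_sym (pull_restrict_iso einj erefl)) _.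
apply: iso_trans (swappable_iso einj (inj_comp e'inj finj) _) _.
  move=> k; apply: swappable_trans (swappable_sym (cP k)) _.
  by rewrite -fc; apply: c'P.
apply: pull_restrict_iso; first exact: inj_comp.
apply/seteqP; split=> _ [k _ <-]; last by exists (f k).
by have [v <-] := fsurj k; exists v.
Qed.

End Swap.

(** * Directed classes are ages *)

(** The enumeration lists the values of [h] first, then the remaining points. *)
Lemma extend_injection (T : Type) (n q : nat) (e : 'I_q -> T) (h : 'I_n -> T) :
  bijective e -> injective h ->
  exists (nq : n <= q) (g : 'I_q -> T),
    bijective g /\ forall k, g (widen_ord nq k) = h k.
Proof.
move=> ebij hinj; have [d eK dK] := ebij.
pose a := d \o h; have ainj : injective a := inj_comp (can_inj dK) hinj.
have nq : n <= q by have := leq_card _ ainj; rewrite !card_ord.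
pose l := codom a ++ [seq x <- enum 'I_q | x \notin codom a].
have lu : uniq l.
  rewrite cat_uniq map_inj_uniq ?enum_uniq // filter_uniq ?enum_uniq // andbT.
  by apply/hasPn => x; rewrite mem_filter => /andP[].
have lall x : x \in l.
  by rewrite mem_cat mem_filter mem_enum andbT orbN.
have ls : size l = q.
  by rewrite -[RHS]card_ord; apply/eqP; rewrite -(card_uniqP lu); apply/eqP/eq_card => x; rewrite lall inE.
pose b (k : 'I_q) := nth k l k.
have bE k k' : b k = nth k' l k by apply: set_nth_default; rewrite ls.
have binj : injective b.
  move=> k k'; rewrite (bE k' k) /b => /eqP; rewrite nth_uniq ?ls // => /eqP.
  exact: val_inj.
exists nq, (e \o b); split.
  by apply: bij_comp ebij _; apply: injF_bij.
move=> k; rewrite /= (bE _ (a k)) nth_cat size_codom card_ord /= ltn_ord.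
rewrite (nth_map k) ?size_enum_ord // nth_ord_enum /a /=; exact: dK.
Qed.

Section Limits.
Variables (I : finType) (mu : I -> nat).
Local Notation structure := (structure mu).
Implicit Types R S : structure.

(* [(n, rho)] stands for the structure induced by [rho] on the numbers below [n]. *)
Definition state : Type := nat * (forall i, set ((mu i).-tuple nat)).

Definition piece (s : state) : structure :=
  Structure {k : nat | k < s.1} (fun i => [set t | s.2 i (map_tuple (@sval _ _) t)]%classic).

Definition extends (s s' : state) : Prop := s.1 <= s'.1 /\
  forall i (t : (mu i).-tuple nat), (forall a, tnth t a < s.1) -> s.2 i t <-> s'.2 i t.

Lemma extends_trans s s' s'' : extends s s' -> extends s' s'' -> extends s s''.
Proof.
move=> [n1 e1] [n2 e2]; split=> [|i t tn]; first exact: leq_trans n2.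
by rewrite e1 // e2 // => a; apply: leq_trans (tn a) n1.
Qed.

(** The points [h k] receive the numbers below [n], so that a structure already numbered can be
    enlarged without renumbering. *)
Lemma piece_extend R (n : nat) (h : 'I_n -> dom R) : finite_structure R ->
  injective h -> exists (s : state), [/\ n <= s.1, isomorphic (piece s) R &
    forall i (t : (mu i).-tuple 'I_n),
      s.2 i (map_tuple val t) <-> rel_of R i (map_tuple h t)].
Proof.
move=> /finite_enumP[q [e ebij]] hinj.
have [nq [g [gbij gh]]] := extend_injection ebij hinj.
pose rho i : set ((mu i).-tuple nat) :=
  [set t | exists2 t0 : (mu i).-tuple 'I_q, map_tuple val t0 = t & rel_of R i (map_tuple g t0)]%classic.
have rhoE i (t : (mu i).-tuple 'I_q) : rho i (map_tuple val t) <-> rel_of R i (map_tuple g t).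
  split=> [[t0 t0E]|]; last by exists t.
  suff -> : t0 = t by [].
  apply: eq_from_tnth => a; apply: val_inj.
  by have := congr1 (fun u => tnth u a) t0E; rewrite !tnth_map.
exists (q, rho); split=> //.
  exists (g \o ord_of); split.
    apply: bij_comp gbij _; exists of_ord; [exact: ord_ofK|exact: of_ordK].
  move=> i t; rewrite /= -(map_tupleK ord_of g) -rhoE map_tupleK.
  have -> // : map_tuple (@sval _ _) t = map_tuple (val \o ord_of) t.
  by apply: eq_map_tuple.
move=> i t; have := rhoE i (map_tuple (widen_ord nq) t); rewrite !map_tupleK.
have -> : map_tuple (val \o widen_ord nq) t = map_tuple val t by apply: eq_map_tuple.
have -> // : map_tuple (g \o widen_ord nq) t = map_tuple h t by apply: eq_map_tuple => a; apply: gh.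
Qed.

(** Countability of the codes lets all finite structures be treated one after the other. *)
Definition code : countType := {n : nat & {set {i : I & (mu i).-tuple 'I_n}}}.

Definition decode (c : code) : structure :=
  Structure {k : nat | k < tag c}
    (fun i => [set t | Tagged (fun i => (mu i).-tuple 'I_(tag c)) (map_tuple ord_of t)
                         \in tagged c]%classic).

Lemma decode_surj R : finite_structure R -> exists c, isomorphic (decode c) R.
Proof.
move=> /finite_enumP[n [e ebij]].
pose X := [set u : {i : I & (mu i).-tuple 'I_n} |
  `[< rel_of R (tag u) (map_tuple e (tagged u)) >]].
exists (Tagged (fun n => {set {i : I & (mu i).-tuple 'I_n}}) X), (e \o ord_of); split.
  apply: bij_comp ebij _; exists of_ord; [exact: ord_ofK|exact: of_ordK].
move=> i t; rewrite /= -(map_tupleK ord_of e) /mkset finset.in_set /=.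
by split=> [/asboolP|?]; last exact/asboolP.
Qed.

(** By directedness there is a chain in [D] whose stage [k.+1] absorbs the structure coded by [k] if
    it belongs to [D]. Every member of [D] embeds in the union, and a finite part of the union lies
    in some stage. *)
Lemma directed_age (D : set structure) :
  hereditary D -> (forall R, D R -> finite_structure R) -> (exists R, D R) ->
  (forall R S, D R -> D S -> exists2 U, D U & embeds R U /\ embeds S U) ->
  exists S, D = age S.
Proof.
move=> Dher Dfin [R0 DR0] Ddir.
have Diso R S : isomorphic R S -> D S -> D R by move=> /iso_embeds RS DS; apply: Dher RS.
have [s0 [_ s0R _]] := piece_extend (h := fun i : 'I_0 => False_rect _ (notF (ltn_ord i)))
  (Dfin _ DR0) (fun i => match notF (ltn_ord i) with end).
have Ds0 : D (piece s0) by apply: Diso s0R DR0.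
have step (u : state * nat) : exists s', D (piece u.1) ->
    [/\ D (piece s'), extends u.1 s' &
        forall c, unpickle u.2 = Some c -> D (decode c) -> embeds (decode c) (piece s')].
  case: u => s k /=; have [Ds|nDs] := pselect (D (piece s)); last by exists s.
  case: (unpickle k) => [c|]; last by exists s; split.
  have [Dc|nDc] := pselect (D (decode c)); last by exists s; split=> // _ [<-].
  have [U DU [/embedsP[f [finj fR]] cU]] := Ddir _ _ Ds Dc.
  have [s' [ns' s'U s'R]] := piece_extend (Dfin _ DU)
    (inj_comp finj (can_inj (@of_ordK s.1))).
  exists s' => _; split.
  - exact: Diso s'U DU.
  - split=> // i t tn; pose t1 := [tuple Ordinal (tn a) | a < mu i].
    have t1E : map_tuple val t1 = t.
      by apply: eq_from_tnth => a; rewrite tnth_map tnth_mktuple.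
    rewrite -{2}t1E s'R -map_tupleK -fR /= map_tupleK.
    have -> // : map_tuple ((@sval _ _) \o of_ord) t1 = t.
    by rewrite -[RHS]t1E; apply: eq_map_tuple.
  - by move=> _ [<-] _; apply: embeds_trans cU (iso_embeds (iso_sym s'U)).
have [next nextP] := choice step.
pose fix st k : state := if k is k'.+1 then next (st k', k') else s0.
have Dst k : D (piece (st k)).
  by elim: k => //= k IHk; case: (nextP (st k, k) IHk).
have st_ext k l : k <= l -> extends (st k) (st l).
  move=> /subnKC <-; elim: (l - k) => [|d IHd]; first by rewrite addn0.
  rewrite addnS; apply: extends_trans IHd _.
  by case: (nextP (st (k + d), k + d) (Dst _)).
pose S : structure := Structure {x : nat | exists k, x < (st k).1}
  (fun i => [set t | exists2 k, forall a, sval (tnth t a) < (st k).1 &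
                      (st k).2 i (map_tuple (@sval _ _) t)]%classic).
have relS k i (t : (mu i).-tuple (dom S)) : (forall a, sval (tnth t a) < (st k).1) ->
    rel_of S i t <-> (st k).2 i (map_tuple (@sval _ _) t).
  move=> tk; split=> [[l tl rl]|rk]; last by exists k.
  have tk' a : tnth (map_tuple (@sval _ _) t) a < (st k).1 by rewrite tnth_map.
  have tl' a : tnth (map_tuple (@sval _ _) t) a < (st l).1 by rewrite tnth_map.
  have [_ ek] := st_ext k (maxn k l) (leq_maxl _ _).
  have [_ el] := st_ext l (maxn k l) (leq_maxr _ _).
  by rewrite ek // -el.
exists S; apply/seteqP; split=> R.
  move=> DR; apply/ageP; split; first exact: Dfin.
  have [c cR] := decode_surj (Dfin _ DR).
  have [_ _ /(_ c (pickleK c) (Diso _ _ cR DR)) cP] := nextP (st (pickle c), pickle c) (Dst _).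
  apply: embeds_trans (iso_embeds (iso_sym cR)) _; apply: embeds_trans cP _.
  rewrite -/(st (pickle c).+1); set k := (pickle c).+1; apply/embedsP.
  exists (fun x : dom (piece (st k)) => exist _ (sval x) (ex_intro _ k (svalP x)) : dom S).
  split=> [[x xk] [y yk] /(congr1 (@sval _ _)) /= xy|i t].
    by case: _ / xy yk => yk; congr exist; apply: bool_irrelevance.
  rewrite (relS k) => [|a]; last by rewrite tnth_map; apply: (svalP (tnth t a)).
  by rewrite map_tupleK.
move=> /ageP[Rfin /embedsP[f [finj fR]]].
have [n [e [d eK dK]]] := (finite_enumP R).1 Rfin.
have bound (a : 'I_n) : exists k, sval (f (e a)) < (st k).1 := svalP (f (e a)).
have [b bP] := choice bound.
pose k := \max_a b a.
have fk x : sval (f x) < (st k).1.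
  rewrite -(dK x); apply: leq_trans (bP (d x)) _.
  by have [] := st_ext (b (d x)) k (leq_bigmax _).
apply: (Dher _ _ (Dst k)); apply/embedsP.
exists (fun x => exist _ (sval (f x)) (fk x)); split.
  move=> x y /(congr1 (@sval _ _)) /= fxy; apply: finj.
  case: (f x) (f y) fxy => [u uP] [v vP] /= uv; case: _ / uv vP => vP.
  by congr exist; apply: Prop_irrelevance.
move=> i t; rewrite fR (relS k) => [|a]; last by rewrite tnth_map.
by rewrite /= !map_tupleK.
Qed.

End Limits.

(** * Minimal unbounded classes *)

Section Minimality.
Local Open Scope classical_set_scope.
Variables (I : finType) (mu : I -> nat).
Local Notation structure := (structure mu).
Implicit Types (R S U : structure) (C D H : set structure).

Definition bounded C : Prop := exists N, forall R, C R -> cx N R.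

Lemma hereditary_avoid C R : hereditary C -> hereditary (C `&` [set S | ~ embeds R S]).
Proof.
move=> Cher S T [CT nRT] ST; split; first exact: Cher ST.
by move=> RS; apply: nRT; apply: embeds_trans ST.
Qed.

(** No member of [C] contains both [R] and [S], so each omits one of them. *)
Lemma not_directed C : hereditary C ->
  ~ (forall R S, C R -> C S -> exists2 U, C U & embeds R U /\ embeds S U) ->
  exists R S, [/\ C R, C S &
    C = (C `&` [set U | ~ embeds R U]) `|` (C `&` [set U | ~ embeds S U])].
Proof.
move=> Cher /existsNP[R /existsNP[S /not_implyP[CR /not_implyP[CS none]]]].
exists R, S; split=> //; apply/seteqP; split=> U; last by case=> [] [].
move=> CU; have [RU|RU] := pselect (embeds R U); last by left.
by right; split=> // SU; apply: none; exists U.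
Qed.

(** Iteration gives decreasing hereditary classes [h n] and structures [x n] in [h n] but not in
    [h n.+1]. By [cx_wqo] some [x a] embeds in [x b] with [a < b], and heredity puts [x a] into
    [h a.+1]. *)
Lemma bounded_descent (N : nat) (P : set structure -> Prop) :
  (forall H, P H -> hereditary H) ->
  (forall H, P H -> exists H' R,
     [/\ P H', H' `<=` H, H R, ~ H' R & finite_structure R /\ cx N R]) ->
  forall H, ~ P H.
Proof.
move=> Pher Pstep H0 PH0.
have step H : exists u : set structure * structure, P H ->
    [/\ P u.1, u.1 `<=` H, H u.2, ~ u.1 u.2 & finite_structure u.2 /\ cx N u.2].
  have [PH|nPH] := pselect (P H).
    by have [H' [R HR]] := Pstep H PH; exists (H', R).
  have [_ [R _]] := Pstep _ PH0.
  by exists (H, R).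
have [next nextP] := choice step.
pose fix h n := if n is n'.+1 then (next (h n')).1 else H0.
have Ph n : P (h n) by elim: n => //= n /nextP[].
have hS a b : (a <= b)%N -> h b `<=` h a.
  move=> /subnKC <-; elim: (b - a)%N => [|d IHd]; first by rewrite addn0.
  by rewrite addnS; apply: subset_trans IHd; case: (nextP _ (Ph (a + d)%N)).
pose x n := (next (h n)).2.
have [||a [b [ab xab]]] := @cx_wqo _ mu N x.
- by move=> n; case: (nextP _ (Ph n)) => _ _ _ _ [].
- by move=> n; case: (nextP _ (Ph n)) => _ _ _ _ [].
have [_ _ _ nxa _] := nextP _ (Ph a); apply: nxa.
have [_ _ xb _ _] := nextP _ (Ph b).
by apply: (Pher _ (Ph a.+1)) xab; apply: (hS a.+1 b).
Qed.

Lemma deletion_embeds R (x : dom R) : embeds (restrict [set y | y <> x]) R.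
Proof. by exists [set y | y <> x]; apply: iso_refl. Qed.

Lemma deletion_card n n' R (x : dom R) (e : 'I_n -> dom R)
    (e' : 'I_n' -> dom (restrict [set y | y <> x])) :
  bijective e -> bijective e' -> (n' < n)%N.
Proof.
move=> [d eK dK] e'bij.
pose f (o : option 'I_n') := d (if o is Some k then sval (e' k) else x).
have finj : injective f.
  have dinj := can_inj dK.
  case=> [k|] [l|] // /dinj.
  - by move=> /(@embedding_val _ _ R _).1 /(bij_inj e'bij) ->.
  - by move=> ekx; case: (svalP (e' k)).
  - by move=> ekx; case: (svalP (e' l)).
by have := leq_card _ finj; rewrite card_option !card_ord.
Qed.

(** A member of [C] outside [D] with the fewest points will do. *)
Lemma minimal_outside C D : hereditary C -> (forall R, C R -> finite_structure R) ->
  ~ C `<=` D -> exists R, [/\ C R, ~ D R & forall x : dom R, D (restrict [set y | y <> x])].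
Proof.
move=> Cher Cfin /existsNP[R0 /not_implyP[CR0 nDR0]].
pose Q n := `[< exists R (e : 'I_n -> dom R), [/\ C R, ~ D R & bijective e] >].
have exQ : exists n, Q n.
  have [n [e ebij]] := (finite_enumP R0).1 (Cfin _ CR0).
  by exists n; apply/asboolP; exists R0, e.
case: (ex_minnP exQ) => n /asboolP[R [e [CR nDR ebij]]] nmin.
exists R; split=> // x; apply: contrapT => nD.
have Cx : C (restrict [set y | y <> x]) := Cher _ _ CR (deletion_embeds x).
have [n' [e' e'bij]] := (finite_enumP _).1 (Cfin _ Cx).
have /nmin : Q n' by apply/asboolP; exists (restrict [set y | y <> x]), e'.
by rewrite leqNgt (deletion_card ebij e'bij).
Qed.

(* If the intersection is bounded, a minimal member of [C] outside it has all its
   one-point deletions inside, hence is bounded too, by [cx_one_point]. *)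
Lemma bounded_chain (F : set (set structure)) :
  F !=set0 -> total_on F subset ->
  (forall C, F C -> hereditary C) ->
  (forall C, F C -> forall R, C R -> finite_structure R) ->
  bounded (\bigcap_(C in F) C) -> exists2 C, F C & bounded C.
Proof.
move=> [C0 FC0] tot her fin [N bN]; apply: contrapT => none.
pose E := \bigcap_(C in F) C.
apply: (@bounded_descent (one_point_bound (arity mu) N.+1) F _ _ C0) => // C FC.
have nsub : ~ C `<=` E.
  by move=> CE; apply: none; exists C => //; exists N => R /CE; apply: bN.
have [R [CR nER Rx]] := minimal_outside (her C FC) (fin C FC) nsub.
have [C' [FC' nC'R]] : exists C', F C' /\ ~ C' R.
  apply: contrapT => all; apply: nER => C' FC'; apply: contrapT => nC'R.
  by apply: all; exists C'.
have Rfin := fin C FC R CR.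
exists C', R; split=> //.
  by case: (tot C C' FC FC') => // CC'; case: nC'R; apply: CC'.
split=> //; apply: cx_one_point => // x.
exact: cx_leq (leqnSn N) (bN _ (Rx x)).
Qed.

Lemma bounded_setU C D : bounded C -> bounded D -> bounded (C `|` D).
Proof.
move=> [M CM] [N DN]; exists (maxn M N) => R [/CM|/DN]; apply: cx_leq.
  exact: leq_maxl.
exact: leq_maxr.
Qed.

(** Zorn's lemma is applied to the sets removed from [C]: a maximal one leaves a minimal unbounded
    class. Unions of removed sets give intersections, treated by [bounded_chain]; the empty chain
    leaves [C] itself. *)
Lemma minimal_unbounded C : hereditary C -> (forall R, C R -> finite_structure R) ->
  ~ bounded C -> exists D, [/\ D `<=` C, hereditary D, ~ bounded D &
    forall H, H `<=` D -> hereditary H -> ~ bounded H -> H = D].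
Proof.
move=> Cher Cfin Cunb.
pose P (X : set structure) := hereditary (C `\` X) /\ ~ bounded (C `\` X).
have [|A [[Aher Aunb] Amax]] := @Zorn_bigcup structure P.
  move=> F FP tot; have [[X0 FX0]|F0] := pselect (F !=set0); last first.
    have -> : \bigcup_(X in F) X = set0.
      by apply/seteqP; split=> // R [X FX _]; apply: F0; exists X.
    by rewrite /P setD0.
  pose G := [set C `\` X | X in F].
  have capE : C `\` \bigcup_(X in F) X = \bigcap_(H in G) H.
    apply/seteqP; split=> R.
      move=> [CR nR] _ [X FX <-]; split=> // XR; apply: nR; by exists X.
    move=> GR; split; first by have [] := GR (C `\` X0) (ex_intro2 _ _ X0 FX0 erefl).
    by move=> [X FX XR]; have [] := GR (C `\` X) (ex_intro2 _ _ X FX erefl).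
  rewrite /P capE; split.
    move=> R S GS RS _ [X FX <-]; have [her _] := FP X FX.
    by apply: her RS; apply: GS; exists X.
  move=> bG; have [||||_ [X FX <-]] := @bounded_chain G _ _ _ _ bG.
  - by exists (C `\` X0), X0.
  - move=> _ _ [X FX <-] [Y FY <-]; case: (tot X Y FX FY) => XY; [right|left];
    by move=> R [CR nR]; split=> // /XY.
  - by move=> _ [X FX <-]; have [] := FP X FX.
  - by move=> _ [X FX <-] R [CR _]; apply: Cfin.
  by have [] := FP X FX.
exists (C `\` A); split=> // H HD Hher Hunb.
apply/seteqP; split=> // R DR; apply: contrapT => nHR.
have CH : C `\` (A `|` (C `\` H)) = H.
  apply/seteqP; split=> S.
    by move=> [CS nS]; apply: contrapT => nHS; apply: nS; right.
  by move=> HS; have [CS nAS] := HD S HS; split=> // -[|[]].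
apply: (Amax (A `|` (C `\` H))); last by rewrite /P CH.
split; first by move=> S AS; left.
by move=> sub; case: DR => CR; apply; apply: sub; right.
Qed.

(** If [D] were not directed, it would be the union of two proper hereditary subclasses, bounded by
    minimality, hence bounded. The age of a structure without finite decomposition is unbounded by
    [cx_fmd], so minimality among classes gives minimality among ages. *)
Lemma minimal_unbounded_age C : hereditary C ->
  (forall R, C R -> finite_structure R) -> ~ bounded C ->
  exists D, D `<=` C /\ minimal_age_without_fmd D.
Proof.
move=> Cher Cfin /(minimal_unbounded Cher Cfin)[D [DC Dher Dunb Dmin]].
have Dfin R : D R -> finite_structure R by move=> /DC /Cfin.
exists D; split=> //.
have [||S DE] := directed_age Dher Dfin.
- apply: contrapT => D0; apply: Dunb; exists 0%N => R DR.
  by case: D0; exists R.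
- apply: contrapT => /(not_directed Dher)[R [S [DR DS DE]]].
  apply: Dunb; rewrite DE; apply: bounded_setU; apply: contrapT => unb.
    have := Dmin _ (@subIsetl _ _ _) (@hereditary_avoid D R Dher) unb.
    by move=> E; move: DR; rewrite -E => -[_]; apply; apply: embeds_refl.
  have := Dmin _ (@subIsetl _ _ _) (@hereditary_avoid D S Dher) unb.
  by move=> E; move: DS; rewrite -E => -[_]; apply; apply: embeds_refl.
split.
  exists S; split=> // /(fmd_cx (@arity_max _ mu)) bS; apply: Dunb.
  by rewrite DE.
move=> _ [R [nfmd ->]] RD; apply: Dmin => //; first exact: age_hereditary.
by move=> [N bN]; apply: nfmd; apply: cx_fmd bN.
Qed.

(** * Bounded classes as finite unions of ages *)

Definition finite_union_of_fmd_ages C : Prop :=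
  exists (n : nat) (S : 'I_n -> structure),
    (forall k, has_finite_monomorphic_decomposition (S k)) /\
    C = \bigcup_(k in [set: 'I_n]) age (S k).

Lemma finite_union_setU C D : finite_union_of_fmd_ages C ->
  finite_union_of_fmd_ages D -> finite_union_of_fmd_ages (C `|` D).
Proof.
move=> [m [S [Sfmd ->]]] [n [T [Tfmd ->]]].
exists (m + n)%N, (fun k => match split k with inl i => S i | inr j => T j end).
split; first by move=> k; case: (split k).
apply/seteqP; split=> R.
- case=> [] [k _ Rk].
    by exists (lshift n k) => //; rewrite (unsplitK (inl k)).
  by exists (rshift m k) => //; rewrite (unsplitK (inr k)).
- by move=> [k _]; case: (split k) => j Rj; [left|right]; exists j.
Qed.

(** Descent on the hereditary subclasses that are not finite unions: such a class is not directed,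
    otherwise it would be an age, so it is the union of two proper hereditary subclasses, one of
    which is again not a finite union. *)
Lemma bounded_union C : hereditary C -> (forall R, C R -> finite_structure R) ->
  bounded C -> finite_union_of_fmd_ages C.
Proof.
move=> Cher Cfin [N bN]; apply: contrapT => nC.
pose P H := [/\ hereditary H, H `<=` C & ~ finite_union_of_fmd_ages H].
have PC : P C by split=> // R.
apply: (@bounded_descent N P _ _ C PC) => [H []//|H [Hher HC nH]].
have Hfin R : H R -> finite_structure R by move=> /HC /Cfin.
have [[R0 HR0]|H0] := pselect (exists R, H R); last first.
  (* The empty class is the union of no ages. *)
  case: nH; exists 0%N, (fun i : 'I_0 => False_rect structure (notF (ltn_ord i))); split=> [[]//|].
  apply/seteqP; split=> [R HR|R [[]//]].
  by case: H0; exists R.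
have [dir|/(not_directed Hher)[R [S [HR HS HE]]]] := pselect (forall R S, H R -> H S ->
    exists2 U, H U & embeds R U /\ embeds S U).
  have [S HE] := directed_age Hher Hfin (ex_intro _ R0 HR0) dir.
  case: nH; exists 1%N, (fun=> S); split=> [_|].
    by apply: (@cx_fmd _ _ N) => T; rewrite -HE => /HC; apply: bN.
  by rewrite HE; apply/seteqP; split=> [T ST|T [_ _ //]]; exists ord0.
have avoid T : H T -> ~ finite_union_of_fmd_ages (H `&` [set U | ~ embeds T U]) ->
    exists H' R, [/\ P H', H' `<=` H, H R, ~ H' R & finite_structure R /\ cx N R].
  move=> HT nfu; exists (H `&` [set U | ~ embeds T U]), T; split=> //.
  - by split=> // [|U [/HC]]; first exact: hereditary_avoid.
  - by move=> [_ nTT]; apply: nTT; apply: embeds_refl.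
  - by split; [exact: Hfin|apply: bN; apply: HC].
have [fR|] := pselect (finite_union_of_fmd_ages (H `&` [set U | ~ embeds R U])).
  apply: (avoid S HS) => fS; apply: nH; rewrite HE.
  exact: finite_union_setU.
exact: avoid.
Qed.

End Minimality.

Local Open Scope classical_set_scope.

Theorem theorem1p2 (I : finType) (mu : I -> nat) (C : set (structure mu))
  (Cfin : forall R : structure mu, C R -> finite_structure R)
  (Cher : hereditary C) :
  (exists (n : nat) (S : 'I_n -> structure mu),
      (forall k : 'I_n, has_finite_monomorphic_decomposition (S k)) /\
      C = \bigcup_(k in [set: 'I_n]) age (S k))
  \/
  (exists D : set (structure mu), D `<=` C /\ minimal_age_without_fmd D).
Proof.
have [bC|uC] := pselect (bounded C); first by left; apply: bounded_union.
by right; apply: minimal_unbounded_age.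
Qed.
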